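(* Let $R$ be a complete local Gorenstein ring of dimension $d$ and let $A$ be an $R$-algebra. Then the following are equivalent. (i) $A$ is parasolid. (ii) The order ideal $U(A)$ is contained in no annihilator of a paraclass, i.e. for every paraclass $c\in H^d_{\mathfrak m}(R)$ one has $U(A)\not\subseteq\operatorname{Ann}_R c$.
   Context: All rings are commutative with $1$; local rings are Noetherian. Let $R$ be a Noetherian local ring of dimension $d$ with maximal ideal $\mathfrak{m}$. Elements $x_1,\ldots,x_d\in R$ are called parameters if $V(x_1,\ldots,x_d)=V(\mathfrak{m})$; they define, via Čech cohomology, a class $1/(x_1\cdots x_d)\in H^d_{\mathfrak m}(R)$, called a paraclass. For an $R$-algebra $A$, $H^d_{\mathfrak m}(A)$ is the local cohomology of $A$ as an $R$-module. $A$ is called parasolid if every paraclass $0\neq c\in H^d_{\mathfrak m}(R)$ has non-zero image in $H^d_{\mathfrak m}(A)$. The order ideal of $A$ is $U(A)=\{\varphi(1):\ \varphi:A\to R \text{ an } R\text{-linear map}\}\subseteq R$. *)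

(* Defs.v *)
From HB Require Import structures.
From mathcomp Require Import all_boot all_algebra.
From mathcomp Require Import generic_quotient ring_quotient.
From mathcomp Require Import ring.
From mathcomp Require Import boolp classical_sets.

Set Implicit Arguments.
Unset Strict Implicit.
Unset Printing Implicit Defensive.

Import GRing.Theory.
Local Open Scope classical_set_scope.
Local Open Scope ring_scope.
Local Open Scope quotient_scope.

(* Ideals are [set R]; the library's [idealr_closed] is not used because it
   only describes proper ideals given by boolean predicates. *)
Section Ideals.
Variable R : comNzRingType.
Implicit Types (I P m S : set R) (d n : nat).

Definition ideal I : Prop :=
  [/\ I 0, forall x y, I x -> I y -> I (x + y) & forall a x, I x -> I (a * x)].

Definition ideal_gen S : set R := smallest ideal S.

Definition noetherian : Prop :=
  forall I, ideal I -> exists s : seq R, I = ideal_gen [set` s].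

Definition prime_ideal P : Prop :=
  [/\ ideal P, ~ P 1 & forall x y, P (x * y) -> P x \/ P y].

Definition maximal_ideal m : Prop :=
  [/\ ideal m, ~ m 1 & forall I, ideal I -> ~ I 1 -> m `<=` I -> I = m].

Definition local_ring m : Prop :=
  maximal_ideal m /\ forall m', maximal_ideal m' -> m' = m.

Definition prime_chain n : Prop :=
  exists P : nat -> set R,
    (forall i, (i <= n)%N -> prime_ideal (P i)) /\
    (forall i, (i < n)%N -> P i `<` P i.+1).

Definition krull_dim d : Prop :=
  prime_chain d /\ forall n, prime_chain n -> (n <= d)%N.

Definition idealX I n : set R :=
  ideal_gen [set x | exists a : 'I_n -> R,
                       (forall i, I (a i)) /\ x = \prod_i a i].

(* Separated and complete for the [m]-adic topology. *)
Definition adically_complete m : Prop :=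
  (forall x, (forall n, idealX m n x) -> x = 0) /\
  (forall u : nat -> R,
     (forall n, exists N, forall i j,
        (N <= i)%N -> (N <= j)%N -> idealX m n (u i - u j)) ->
     exists l, forall n, exists N, forall i, (N <= i)%N -> idealX m n (u i - l)).

Definition zero_locus S : set (set R) := [set P | prime_ideal P /\ S `<=` P].

Definition parameters m d (x : 'I_d -> R) : Prop :=
  zero_locus (range x) = zero_locus m.

Definition Ann (M : lmodType R) (v : M) : set R := [set r | r *: v = 0].

End Ideals.

Section Gorenstein.
Variable R : comNzRingType.

Definition injective_module (E : lmodType R) : Prop :=
  forall (M N : lmodType R) (i : {linear M -> N}) (g : {linear M -> E}),
    injective i -> exists h : {linear N -> E}, forall x, h (i x) = g x.

(* [M] has an injective resolution 0 -> M -> I 0 -> ... -> I n -> 0. *)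
Definition injdim_le (M : lmodType R) (n : nat) : Prop :=
  exists (I : nat -> lmodType R) (e : {linear M -> I 0})
         (delta : forall k, {linear I k -> I k.+1}),
    (forall k, injective_module (I k)) /\
    injective e /\
    (forall z, delta 0 z = 0 <-> exists y, e y = z) /\
    (forall k z, delta k.+1 z = 0 <-> exists y, delta k y = z) /\
    (forall k, (n < k)%N -> forall z : I k, z = 0).

(* For a Noetherian local ring: finite injective dimension over itself. *)
Definition gorenstein : Prop := exists n, injdim_le R^o n.

End Gorenstein.

Section Localization.
Variables (R : comNzRingType) (f : R).

Section Module.
Variable M : lmodType R.

(* [(u, n)] stands for the fraction u / f^n. *)
Definition frac_equiv (p q : M * nat) : bool :=
  `[< exists k, f ^+ (k + q.2) *: p.1 = f ^+ (k + p.2) *: q.1 >].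

Lemma frac_equiv_class : equiv_class_of frac_equiv.
Proof.
split=> [p|p q|q p r].
- by apply/asboolP; exists 0.
- by apply/asboolP/asboolP => -[k h]; exists k.
- move=> /asboolP[k hk] /asboolP[l hl]; apply/asboolP.
  exists (k + l + q.2)%N.
  have -> : (k + l + q.2 + r.2 = (l + r.2) + (k + q.2))%N by ring.
  have -> : (k + l + q.2 + p.2 = (k + p.2) + (l + q.2))%N by ring.
  by rewrite exprD -scalerA hk scalerA mulrC -scalerA hl scalerA -exprD.
Qed.

Canonical frac_equivRel := EquivRelPack frac_equiv_class.

Definition loc : Type := {eq_quot frac_equiv}.
HB.instance Definition _ := Choice.on loc.
HB.instance Definition _ := EqQuotient.on loc.

Definition frac (u : M) (n : nat) : loc := \pi_loc (u, n).

Lemma frac_eqP u n v k :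
  frac u n = frac v k <-> exists l, f ^+ (l + k) *: u = f ^+ (l + n) *: v.
Proof.
rewrite /frac; split=> [/eqP|h]; last apply/eqP.
  by rewrite piE => /asboolP.
by rewrite piE; apply/asboolP.
Qed.

Lemma fracP (z : loc) : exists u n, z = frac u n.
Proof. by exists (repr z).1, (repr z).2; rewrite /frac -surjective_pairing reprK. Qed.

Lemma frac_repr (z : loc) : frac (repr z).1 (repr z).2 = z.
Proof. by rewrite /frac -surjective_pairing reprK. Qed.

Lemma frac_expand u n k : frac (f ^+ k *: u) (k + n) = frac u n.
Proof. by apply/frac_eqP; exists 0%N; rewrite !add0n scalerA -exprD addnC. Qed.

Definition loc_add (y z : loc) : loc :=
  let p := repr y in let q := repr z in
  frac (f ^+ q.2 *: p.1 + f ^+ p.2 *: q.1) (p.2 + q.2).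
Definition loc_opp (z : loc) : loc := frac (- (repr z).1) (repr z).2.
Definition loc_scale (a : R) (z : loc) : loc := frac (a *: (repr z).1) (repr z).2.

(* A function of (u, n) that is compatible with multiplying numerator and
   denominator by powers of f depends only on the fraction. *)
Lemma frac_lift (T : Type) (h : M -> nat -> T) :
  (forall u n k, h (f ^+ k *: u) (k + n)%N = h u n) ->
  forall u n, h (repr (frac u n)).1 (repr (frac u n)).2 = h u n.
Proof.
move=> hh u n; set p := repr _.
have /frac_eqP[l hl] : frac p.1 p.2 = frac u n by rewrite frac_repr.
by rewrite -(hh p.1 p.2 (l + n)%N) hl -(hh u n (l + p.2)%N) addnAC.
Qed.

Lemma loc_addE u n v k :
  loc_add (frac u n) (frac v k) = frac (f ^+ k *: u + f ^+ n *: v) (n + k).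
Proof.
rewrite /loc_add /=.
rewrite (@frac_lift _ (fun u n => frac (f ^+ (repr (frac v k)).2 *: u
  + f ^+ n *: (repr (frac v k)).1) (n + (repr (frac v k)).2))); last first.
  move=> {}u {}n l; rewrite -addnA -[RHS](frac_expand _ _ l); congr frac.
  by rewrite scalerDr !scalerA -!exprD; congr (f ^+ _ *: _ + _); ring.
rewrite (@frac_lift _ (fun v k => frac (f ^+ k *: u + f ^+ n *: v) (n + k))) //.
move=> {}v {}k l; rewrite addnCA -[RHS](frac_expand _ _ l); congr frac.
by rewrite scalerDr !scalerA -!exprD; congr (_ + f ^+ _ *: _); ring.
Qed.

Lemma loc_oppE u n : loc_opp (frac u n) = frac (- u) n.
Proof.
rewrite /loc_opp (@frac_lift _ (fun u n => frac (- u) n)) //.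
by move=> {}u {}n l; rewrite -scalerN frac_expand.
Qed.

Lemma loc_scaleE a u n : loc_scale a (frac u n) = frac (a *: u) n.
Proof.
rewrite /loc_scale (@frac_lift _ (fun u n => frac (a *: u) n)) //.
by move=> {}u {}n l; rewrite scalerA mulrC -scalerA frac_expand.
Qed.

Lemma loc_addA : associative loc_add.
Proof.
move=> x y z; have [u [n ->]] := fracP x; have [v [k ->]] := fracP y.
have [w [l ->]] := fracP z; rewrite !loc_addE addnA; congr frac.
rewrite !scalerDr !scalerA -!exprD addrA.
by congr (f ^+ _ *: _ + f ^+ _ *: _ + _); ring.
Qed.

Lemma loc_addC : commutative loc_add.
Proof.
move=> x y; have [u [n ->]] := fracP x; have [v [k ->]] := fracP y.
by rewrite !loc_addE addrC addnC.
Qed.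

Lemma loc_add0 : left_id (frac 0 0) loc_add.
Proof.
move=> x; have [u [n ->]] := fracP x.
by rewrite loc_addE scaler0 add0r expr0 scale1r.
Qed.

Lemma loc_addN : left_inverse (frac 0 0) loc_opp loc_add.
Proof.
move=> x; have [u [n ->]] := fracP x.
rewrite loc_oppE loc_addE scalerN addNr.
by apply/frac_eqP; exists 0%N; rewrite !scaler0.
Qed.

HB.instance Definition _ :=
  GRing.isZmodule.Build loc loc_addA loc_addC loc_add0 loc_addN.

Lemma fracD u n v k :
  frac u n + frac v k = frac (f ^+ k *: u + f ^+ n *: v) (n + k).
Proof. exact: loc_addE. Qed.

Lemma frac0 n : frac 0 n = 0.
Proof. by apply/frac_eqP; exists 0%N; rewrite !scaler0. Qed.

Lemma fracDl n u v : frac (u + v) n = frac u n + frac v n.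
Proof. by rewrite fracD -scalerDr frac_expand. Qed.

Lemma loc_scaleA a b z : loc_scale a (loc_scale b z) = loc_scale (a * b) z.
Proof. by have [u [n ->]] := fracP z; rewrite !loc_scaleE scalerA. Qed.

Lemma loc_scale1 : left_id 1 loc_scale.
Proof. by move=> z; have [u [n ->]] := fracP z; rewrite loc_scaleE scale1r. Qed.

Lemma loc_scaleDr : right_distributive loc_scale +%R.
Proof.
move=> a x y; have [u [n ->]] := fracP x; have [v [k ->]] := fracP y.
rewrite fracD !loc_scaleE fracD scalerDr !scalerA.
by rewrite (mulrC a) (mulrC a (f ^+ n)).
Qed.

Lemma loc_scaleDl z : {morph loc_scale^~ z : a b / a + b}.
Proof.
move=> a b; have [u [n ->]] := fracP z.
by rewrite !loc_scaleE scalerDl fracDl.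
Qed.

HB.instance Definition _ := GRing.Zmodule_isLmodule.Build R loc
  loc_scaleA loc_scale1 loc_scaleDr loc_scaleDl.

Lemma fracZ a u n : a *: frac u n = frac (a *: u) n.
Proof. exact: loc_scaleE. Qed.

End Module.

Definition loc_map (M N : lmodType R) (phi : {linear M -> N}) (z : loc M) :
  loc N := frac (phi (repr z).1) (repr z).2.

Lemma loc_mapE (M N : lmodType R) (phi : {linear M -> N}) u n :
  loc_map phi (frac u n) = frac (phi u) n.
Proof.
rewrite /loc_map (@frac_lift _ _ (fun u n => frac (phi u) n)) //.
by move=> {}u {}n k; rewrite linearZ frac_expand.
Qed.

Lemma loc_map_is_linear (M N : lmodType R) (phi : {linear M -> N}) :
  linear (loc_map phi).
Proof.
move=> a y z; have [u [n ->]] := fracP y; have [v [k ->]] := fracP z.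
rewrite fracZ fracD !loc_mapE fracZ fracD.
by rewrite [phi (_ + _)]linearD ![phi (_ *: _)]linearZ.
Qed.

HB.instance Definition _ (M N : lmodType R) (phi : {linear M -> N}) :=
  GRing.isLinear.Build R (loc M) (loc N) _ (loc_map phi) (loc_map_is_linear phi).

End Localization.

Section QuotientModule.
Variables (R : comNzRingType) (M : lmodType R) (N : zmodClosed M).
Hypothesis NZ : GRing.scaler_closed N.

Definition quot_module of GRing.scaler_closed N : Type := Quotient.quot N.
Local Notation Q := (quot_module NZ).
HB.instance Definition _ := GRing.Zmodule.on Q.

Definition quot_class (u : M) : Q := \pi_(Quotient.quot N) u.

Lemma quot_classP (z : Q) : exists u, z = quot_class u.
Proof. by exists (repr (z : Quotient.quot N)); rewrite /quot_class reprK. Qed.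

Lemma quot_class_eq u v : quot_class u = quot_class v <-> u - v \in N.
Proof. by rewrite Quotient.idealrBE; split=> /eqP. Qed.

Lemma quot_classD u v : quot_class (u + v) = quot_class u + quot_class v.
Proof. exact: raddfD. Qed.

Definition quot_scale (a : R) (z : Q) : Q :=
  quot_class (a *: repr (z : Quotient.quot N)).

Lemma quot_scaleE a u : quot_scale a (quot_class u) = quot_class (a *: u).
Proof.
apply/quot_class_eq; rewrite -scalerBr NZ //.
by apply/quot_class_eq; rewrite /quot_class reprK.
Qed.

Lemma quot_scaleA a b z : quot_scale a (quot_scale b z) = quot_scale (a * b) z.
Proof. by have [u ->] := quot_classP z; rewrite !quot_scaleE scalerA. Qed.

Lemma quot_scale1 : left_id 1 quot_scale.
Proof. by move=> z; have [u ->] := quot_classP z; rewrite quot_scaleE scale1r. Qed.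

Lemma quot_scaleDr : right_distributive quot_scale +%R.
Proof.
move=> a y z; have [u ->] := quot_classP y; have [v ->] := quot_classP z.
by rewrite -quot_classD !quot_scaleE scalerDr quot_classD.
Qed.

Lemma quot_scaleDl z : {morph quot_scale^~ z : a b / a + b}.
Proof.
move=> a b; have [u ->] := quot_classP z.
by rewrite !quot_scaleE scalerDl quot_classD.
Qed.

HB.instance Definition _ := GRing.Zmodule_isLmodule.Build R Q
  quot_scaleA quot_scale1 quot_scaleDr quot_scaleDl.

Lemma quot_class_is_linear : linear quot_class.
Proof. by move=> a u v; rewrite quot_classD -quot_scaleE. Qed.

HB.instance Definition _ :=
  GRing.isLinear.Build R M Q _ quot_class quot_class_is_linear.

End QuotientModule.

(* The Cech complex of M on x_1, ..., x_d ends with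
     ... -> \bigoplus_i M_{prod_{j != i} x_j} -> M_{prod_j x_j} -> 0,
   so its d-th cohomology is the cokernel of the last differential. When
   V(x) = V(m), it is the local cohomology H^d_m(M). *)
Section Cech.
Variables (R : comNzRingType) (d : nat) (x : 'I_d -> R).

Definition cech_term (M : lmodType R) := loc (\prod_j x j) M.
Definition cech_prev (M : lmodType R) (i : 'I_d) :=
  loc (\prod_(j | j != i) x j) M.
HB.instance Definition _ M := GRing.Lmodule.on (cech_term M).
HB.instance Definition _ M i := GRing.Lmodule.on (cech_prev M i).

(* u / (prod_{j != i} x_j)^n = (x_i^n u) / (prod_j x_j)^n *)
Definition cech_res (M : lmodType R) (i : 'I_d) (z : cech_prev M i) :
    cech_term M :=
  frac _ (x i ^+ (repr z).2 *: (repr z).1) (repr z).2.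

Lemma cech_prodE i : \prod_j x j = x i * \prod_(j | j != i) x j.
Proof. by rewrite (bigD1 i). Qed.

Lemma cech_resE (M : lmodType R) i (u : M) n :
  @cech_res M i (frac _ u n) = frac _ (x i ^+ n *: u) n.
Proof.
rewrite /cech_res (@frac_lift _ _ _ _ (fun u n => frac _ (x i ^+ n *: u) n)) //.
move=> {}u {}n k; rewrite -[RHS](@frac_expand _ _ _ _ _ k); congr frac.
by rewrite (cech_prodE i) !scalerA exprMn exprD; congr (_ *: _); ring.
Qed.

Lemma cech_res_is_linear (M : lmodType R) i : linear (@cech_res M i).
Proof.
move=> a y z; have [u [n ->]] := fracP y; have [v [k ->]] := fracP z.
rewrite fracZ fracD !cech_resE fracZ fracD; congr frac.
rewrite (cech_prodE i) scalerDr !scalerA !exprMn exprD.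
by congr (_ *: _ + _ *: _); ring.
Qed.

HB.instance Definition _ (M : lmodType R) i :=
  GRing.isLinear.Build R (cech_prev M i) (cech_term M) _ (@cech_res M i)
    (@cech_res_is_linear M i).

Definition cech_diff (M : lmodType R) (z : forall i, cech_prev M i) :
    cech_term M :=
  \sum_(i < d) (-1) ^+ i *: cech_res (z i).

Definition cech_cobound (M : lmodType R) : {pred cech_term M} :=
  [pred w | `[< exists z, w = cech_diff z >]].

Lemma cech_cobound_submod (M : lmodType R) :
  GRing.submod_closed (@cech_cobound M).
Proof.
split; first apply/asboolP.
  by exists (fun=> 0); rewrite /cech_diff big1 // => i _; rewrite linear0 scaler0.
move=> a y z /asboolP[y' ->] /asboolP[z' ->]; apply/asboolP.
exists (fun i => a *: y' i + z' i).
rewrite /cech_diff scaler_sumr -big_split /=; apply: eq_bigr => i _.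
by rewrite linearP scalerDr !scalerA mulrC.
Qed.

HB.instance Definition _ (M : lmodType R) :=
  GRing.isZmodClosed.Build (cech_term M) (@cech_cobound M)
    (GRing.submod_closedB (@cech_cobound_submod M)).

Lemma cech_coboundZ (M : lmodType R) : GRing.scaler_closed (@cech_cobound M).
Proof. exact: GRing.subsemimod_closedZ (@cech_cobound_submod M). Qed.

Definition cech_top (M : lmodType R) : Type := quot_module (@cech_coboundZ M).
HB.instance Definition _ M := GRing.Lmodule.on (cech_top M).

Definition cech_class (M : lmodType R) (w : cech_term M) : cech_top M :=
  quot_class (@cech_coboundZ M) w.

Lemma cech_class_eq (M : lmodType R) (v w : cech_term M) :
  cech_class v = cech_class w <-> exists z, v - w = cech_diff z.
Proof. by rewrite /cech_class quot_class_eq; split=> /asboolP. Qed.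

Lemma cech_classP (M : lmodType R) (c : cech_top M) : exists w, c = cech_class w.
Proof. exact: quot_classP. Qed.

(* The map is described on a representative; [cech_mapE] shows that the choice
   does not matter. *)
Definition cech_map (M N : lmodType R) (phi : {linear M -> N})
    (c : cech_top M) : cech_top N :=
  cech_class (loc_map phi (repr (c : Quotient.quot (@cech_cobound M)))).

Lemma cech_mapE (M N : lmodType R) (phi : {linear M -> N}) (w : cech_term M) :
  cech_map phi (cech_class w) = cech_class (loc_map phi w).
Proof.
have [|z hz] := (cech_class_eq
  (repr (cech_class w : Quotient.quot (@cech_cobound M))) w).1.
  by rewrite /cech_class /quot_class reprK.
apply/cech_class_eq; exists (fun i => loc_map phi (z i)).
rewrite -linearB hz /cech_diff linear_sum; apply: eq_bigr => i _.
rewrite linearZ /=; congr (_ *: _); have [u [n ->]] := fracP (z i).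
by rewrite cech_resE !loc_mapE cech_resE [phi (_ *: _)]linearZ.
Qed.

(* 1 / (x_1 ... x_d) *)
Definition paraclass : cech_top R^o := cech_class (frac _ (1 : R^o) 1).

End Cech.

(* An R-algebra is a ring morphism R -> A. The library's [comAlgType] would
   exclude the zero algebra. *)
Section Algebra.
Variables (R : comNzRingType) (A : comPzRingType) (f : {rmorphism R -> A}).

Definition alg_module : Type := A.
HB.instance Definition _ := GRing.Zmodule.on alg_module.

Definition alg_scale (a : R) (v : alg_module) : alg_module := f a * (v : A).

Lemma alg_scaleA a b v : alg_scale a (alg_scale b v) = alg_scale (a * b) v.
Proof. by rewrite /alg_scale rmorphM mulrA. Qed.
Lemma alg_scale1 : left_id 1 alg_scale.
Proof. by move=> v; rewrite /alg_scale rmorph1 mul1r. Qed.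
Lemma alg_scaleDr : right_distributive alg_scale +%R.
Proof. by move=> a u v; rewrite /alg_scale mulrDr. Qed.
Lemma alg_scaleDl v : {morph alg_scale^~ v : a b / a + b}.
Proof. by move=> a b; rewrite /alg_scale rmorphD mulrDl. Qed.

HB.instance Definition _ := GRing.Zmodule_isLmodule.Build R alg_module
  alg_scaleA alg_scale1 alg_scaleDr alg_scaleDl.

Definition alg_struct (r : R^o) : alg_module := f r.

Lemma alg_struct_is_linear : linear alg_struct.
Proof. by move=> a u v; rewrite /alg_struct rmorphD rmorphM. Qed.

HB.instance Definition _ :=
  GRing.isLinear.Build R R^o alg_module _ alg_struct alg_struct_is_linear.

Definition order_ideal : set R :=
  [set r | exists phi : {linear alg_module -> R^o}, phi (1 : A) = r].

Definition parasolid (m : set R) (d : nat) : Prop :=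
  forall x : 'I_d -> R, parameters m x ->
    paraclass x <> 0 -> cech_map alg_struct (paraclass x) <> 0.

End Algebra.

(* Main.v *)
(* For parameters x, let y be the product of the x_i and q_n the ideal of the
   x_i^n, so that E = H^d_m(R) consists of the fractions r/y^n.

   If phi(1) c <> 0 for a functional phi on A, then the map induced by phi on
   local cohomology shows that c does not vanish in H^d_m(A). This is (ii) => (i).

   For the converse, suppose that the image of c in H^d_m(A) is nonzero. If E is
   an injective hull of the residue field, there is psi : H^d_m(A) -> E with
   psi(c) <> 0. For a in A the element psi(a/y^n) is killed by q_n, hence equal to
   r_n/y^n; the r_n form a Cauchy sequence, and a |-> lim r_n is a functional phi
   on A with phi(1) c = psi(c).

   This needs that x is a regular sequence and that each R/q_n is self-injective,
   for R of finite injective dimension. Both are read off from the groups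
   Ext^i(R/I, R), computed with the given injective resolution, for ideals I only:
   Bass' argument along a maximal chain of primes gives Ext^d(R/m, R) <> 0; the
   lowest and the highest nonzero Ext^i(R/m, R) are in the same degree, so that
   Ext^i(R/m, R) = 0 for i <> d; Ischebeck's theorem then makes x regular; and
   Ext^d(-, R) is exact on the modules R/I with I containing q_n, which is
   self-injectivity of R/q_n. *)
From HB Require Import structures.
From mathcomp Require Import all_boot all_algebra.
From mathcomp Require Import generic_quotient ring_quotient ring zify.
From mathcomp Require Import boolp classical_sets.
Require Import Defs.

Set Implicit Arguments.
Unset Strict Implicit.
Unset Printing Implicit Defensive.

Import GRing.Theory.
Local Open Scope classical_set_scope.
Local Open Scope ring_scope.

(** * Finite generation and ideals *)

Section Span.
Variables (R : comNzRingType) (M : lmodType R).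

(** Peeling off one multiple at a time makes [lincomb (x :: s)], over [R^o], convertible to
    [iadd (lincomb s) x], so that ideals are built generator by generator. *)
Fixpoint lincomb (s : seq M) : set M :=
  if s is x :: s' then [set v | exists c, lincomb s' (v - c *: x)]
  else [set v | v = 0].

Lemma lincomb0 s : lincomb s 0.
Proof. by elim: s => //= x s IH; exists 0; rewrite scale0r subr0. Qed.

Lemma lincombD s u v : lincomb s u -> lincomb s v -> lincomb s (u + v).
Proof.
elim: s u v => [|x s IH] u v /=; first by move=> -> ->; rewrite addr0.
move=> [a ha] [b hb]; exists (a + b).
by rewrite scalerDl opprD addrACA; apply: IH.
Qed.

Lemma lincombZ s a u : lincomb s u -> lincomb s (a *: u).
Proof.
elim: s u => [|x s IH] u /=; first by move=> ->; rewrite scaler0.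
by move=> [c hc]; exists (a * c); rewrite -scalerA -scalerBr; apply: IH.
Qed.

Lemma lincomb_cons x s v : lincomb s v -> lincomb (x :: s) v.
Proof. by move=> h; exists 0; rewrite scale0r subr0. Qed.

Lemma lincomb_mem s (x : M) : x \in s -> lincomb s x.
Proof.
elim: s => // y s IH; rewrite inE => /predU1P[<-|/IH /lincomb_cons h] //.
by exists 1; rewrite scale1r subrr; apply: lincomb0.
Qed.

Definition submod (A : set M) : Prop :=
  [/\ A 0, forall u v, A u -> A v -> A (u + v) & forall a u, A u -> A (a *: u)].

Lemma submodN A u : submod A -> A u -> A (- u).
Proof. by case=> _ _ hZ hu; rewrite -scaleN1r; apply: hZ. Qed.

Lemma submodB A u v : submod A -> A u -> A v -> A (u - v).
Proof. by move=> sA hu hv; case: (sA) => _ hD _; apply: hD => //; apply: submodN. Qed.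

Lemma lincomb_submod s : submod (lincomb s).
Proof. by split; [exact: lincomb0|exact: lincombD|exact: lincombZ]. Qed.

Lemma lincomb_sub A s : submod A -> (forall x, x \in s -> A x) -> lincomb s `<=` A.
Proof.
move=> sA; elim: s => [_ v ->|x s IH hs v [c hc]]; first by case: sA.
have [_ hD hZ] := sA; rewrite -(subrK (c *: x) v); apply: hD.
  by apply: IH => // y ys; apply: hs; rewrite inE ys orbT.
by apply/hZ/hs; rewrite mem_head.
Qed.

Lemma lincomb_subset s t : {subset s <= t} -> lincomb s `<=` lincomb t.
Proof.
by move=> st; apply: lincomb_sub; [exact: lincomb_submod|move=> x /st; exact: lincomb_mem].
Qed.

Lemma lincomb_cat s t u v : lincomb s u -> lincomb t v -> lincomb (s ++ t) (u + v).
Proof.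
move=> hu hv; apply: lincombD.
  by apply: lincomb_subset hu => x; rewrite mem_cat => ->.
by apply: lincomb_subset hv => x; rewrite mem_cat orbC => ->.
Qed.

End Span.

Lemma lincomb_map (R : comNzRingType) (M N : lmodType R) (g : {linear M -> N}) s v :
  lincomb s v -> lincomb (map g s) (g v).
Proof.
elim: s v => [|x s IH] v /=; first by move=> ->; rewrite linear0.
by move=> [c /IH]; rewrite linearB linearZ; exists c.
Qed.

(* A right inverse of g on the generators only, not assumed linear. *)
Lemma lincomb_lift (R : comNzRingType) (M N : lmodType R) (g : {linear M -> N})
    (h : N -> M) s w :
  (forall x, x \in s -> g (h x) = x) -> lincomb s w ->
  exists2 v, lincomb (map h s) v & g v = w.
Proof.
elim: s w => [|x s IH] w hs /=; first by move=> ->; exists 0; rewrite ?linear0.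
move=> [c /IH[y ys|v hv gv]]; first by apply: hs; rewrite inE ys orbT.
exists (v + c *: h x); first by exists c; rewrite addrK.
by rewrite linearD linearZ gv hs ?mem_head // subrK.
Qed.

Section Ideals.
Variable R : comNzRingType.
Implicit Types (I J P Q m : set R) (a b y r : R).

Lemma ideal0 I : ideal I -> I 0. Proof. by case. Qed.
Lemma ideal_add I a b : ideal I -> I a -> I b -> I (a + b).
Proof. by case=> _ h _; apply: h. Qed.
Lemma ideal_mull I a b : ideal I -> I b -> I (a * b).
Proof. by case=> _ _ h; apply: h. Qed.
Lemma ideal_mulr I a b : ideal I -> I a -> I (a * b).
Proof. by move=> hI ha; rewrite mulrC; apply: ideal_mull. Qed.
Lemma ideal_opp I a : ideal I -> I a -> I (- a).
Proof. by move=> hI; rewrite -mulN1r; apply: ideal_mull. Qed.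
Lemma ideal_sub I a b : ideal I -> I a -> I b -> I (a - b).
Proof. by move=> hI ha hb; apply: ideal_add => //; apply: ideal_opp. Qed.
Lemma ideal_subr I a b : ideal I -> I (a - b) -> I b -> I a.
Proof. by move=> hI hab hb; rewrite -(subrK b a); apply: ideal_add. Qed.
Lemma ideal_submod I : @submod R R^o I <-> ideal I.
Proof. by split=> -[? ? ?]. Qed.
Lemma ideal_sum I (T : Type) (s : seq T) (F : T -> R) :
  ideal I -> (forall i, I (F i)) -> I (\sum_(i <- s) F i).
Proof.
by move=> hI hF; apply: big_ind => //; [exact: ideal0|move=> ? ?; exact: ideal_add].
Qed.

Lemma ideal_1 I : ideal I -> I 1 -> I = setT.
Proof. by move=> hI h1; apply/seteqP; split=> // x _; rewrite -(mulr1 x); apply: ideal_mull. Qed.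
Lemma ideal_zero : ideal [set (0 : R)].
Proof. by split=> // [x y -> ->|a x ->]; rewrite ?addr0 ?mulr0. Qed.

Definition iadd I y : set R := [set z | exists r, I (z - r * y)].
Definition colon I y : set R := [set r | I (r * y)].

Lemma iadd_ideal I y : ideal I -> ideal (iadd I y).
Proof.
move=> hI; split; first by exists 0; rewrite mul0r subr0; apply: ideal0.
  move=> u v [a ha] [b hb]; exists (a + b).
  by rewrite mulrDl opprD addrACA; apply: ideal_add.
by move=> a u [r hr]; exists (a * r); rewrite -mulrA -mulrBr; apply: ideal_mull.
Qed.

Lemma colon_ideal I y : ideal I -> ideal (colon I y).
Proof.
move=> hI; split; rewrite /colon /=; first by rewrite mul0r; apply: ideal0.
  by move=> u v; rewrite mulrDl; apply: ideal_add.
by move=> a u; rewrite -mulrA; apply: ideal_mull.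
Qed.

Lemma sub_iadd I y : I `<=` iadd I y.
Proof. by move=> z hz; exists 0; rewrite mul0r subr0. Qed.
Lemma mem_iadd I y : ideal I -> iadd I y y.
Proof. by move=> hI; exists 1; rewrite mul1r subrr; apply: ideal0. Qed.
Lemma iadd_sub I J y : ideal J -> I `<=` J -> J y -> iadd I y `<=` J.
Proof.
by move=> hJ IJ hy z [r /IJ hr]; apply: (ideal_subr hJ hr); apply: ideal_mull.
Qed.
Lemma sub_colon I y : ideal I -> I `<=` colon I y.
Proof. by move=> hI z hz; apply: ideal_mulr. Qed.

Hypothesis R_noeth : noetherian R.

Lemma ideal_lincomb I : ideal I -> exists s : seq R, I = @lincomb R R^o s.
Proof.
move=> /R_noeth[s Is]; exists s; rewrite Is; apply/seteqP; split.
  by apply: smallest_sub; [apply/ideal_submod/lincomb_submod|exact: (@lincomb_mem R R^o)].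
apply: (@lincomb_sub R R^o); last by move=> x xs; apply: sub_gen_smallest.
apply/ideal_submod; split.
- by move=> A [hA _]; apply: ideal0.
- by move=> x y hx hy A hAs; have [hA _] := hAs; apply: ideal_add (hx _ hAs) (hy _ hAs).
- by move=> a x hx A hAs; have [hA _] := hAs; apply: ideal_mull (hx _ hAs).
Qed.

(** A counterexample would start a strictly increasing chain of counterexamples; its union is
    finitely generated, hence contained in one of its terms. *)
Lemma noeth_ind (Phi : set R -> Prop) :
  (forall I, ideal I -> (forall J, ideal J -> I `<=` J -> J <> I -> Phi J) -> Phi I) ->
  forall I, ideal I -> Phi I.
Proof.
move=> step I0 hI0; apply: contrapT => nI0.
pose bad := {I : set R | ideal I /\ ~ Phi I}.
have next (I : bad) : {J : bad | sval I `<=` sval J /\ sval J <> sval I}.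
  apply: cid; case: I => I [hI nI] /=; apply: contrapT => noJ; apply: nI.
  apply: step => // J hJ IJ JI; apply: contrapT => nJ; apply: noJ.
  by exists (exist _ J (conj hJ nJ)).
pose F n := sval (iter n (fun B : bad => sval (next B)) (exist _ I0 (conj hI0 nI0))).
have FS n : F n `<=` F n.+1 /\ F n.+1 <> F n by rewrite /F /=; case: (next _).
have Fmono n k : (n <= k)%N -> F n `<=` F k.
  move=> /subnK <-; elim: (k - n)%N => // l IH.
  by apply: subset_trans IH _; rewrite addSn; have [] := FS (l + n)%N.
have Fid n : ideal (F n) by rewrite /F; case: (iter _ _ _) => B [].
pose U := [set r | exists n, F n r].
have hU : ideal U.
  split; first by exists 0%N; apply: ideal0.
    move=> x y [n hx] [k hy]; exists (maxn n k); apply: ideal_add => //.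
      by apply: Fmono hx; apply: leq_maxl.
    by apply: Fmono hy; apply: leq_maxr.
  by move=> a x [n hx]; exists n; apply: ideal_mull.
have [s Us] := ideal_lincomb hU.
have [n hn] : exists n, forall x, x \in s -> F n x.
  have : forall x, x \in s -> U x by rewrite Us => x /(@lincomb_mem R R^o).
  elim: {Us} s => [|x s IH] hs; first by exists 0%N.
  have [|n hn] := IH; first by move=> y ys; apply: hs; rewrite inE ys orbT.
  have [k hk] := hs x (mem_head _ _); exists (maxn n k) => y.
  rewrite inE => /predU1P[->|/hn]; first by apply: Fmono hk; apply: leq_maxr.
  by apply: Fmono; apply: leq_maxl.
have [_ []] := FS n; apply/seteqP; split; last by have [] := FS n.
apply: subset_trans (_ : U `<=` F n); first by move=> x; exists n.+1.
by rewrite Us; apply: (@lincomb_sub R R^o) => //; apply/ideal_submod.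
Qed.

(** Finitely many generators of [I], adjoined one by one, lead from [J] to [I]. *)
Lemma iadd_ind J (Phi : set R -> Prop) : ideal J -> Phi J ->
  (forall I y, ideal I -> J `<=` I -> Phi I -> Phi (iadd I y)) ->
  forall I, ideal I -> J `<=` I -> Phi I.
Proof.
move=> hJ PJ step I hI JI; have [s Is] := ideal_lincomb hI.
pose L := foldr (fun y A => iadd A y) J.
have hL t : ideal (L t) /\ J `<=` L t.
  elim: t => [|y t [ht Jt]]; first by split.
  by split; [exact: iadd_ideal|apply: subset_trans Jt (@sub_iadd _ _)].
have <- : L s = I.
  apply/seteqP; split.
    have : forall x, x \in s -> I x by rewrite Is => x /(@lincomb_mem R R^o).
    elim: (s) => //= y t IH hs; apply: iadd_sub => //.
      by apply: IH => x xt; apply: hs; rewrite inE xt orbT.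
    by apply: hs; rewrite mem_head.
  rewrite Is; elim: (s) => [|y t IH] x /=; first by move=> ->; apply: ideal0.
  by move=> [c /IH hc]; exists c.
by elim: (s) => //= y t IH; have [ht Jt] := hL t; apply: step.
Qed.

Lemma exists_maximal_over I : ideal I -> ~ I 1 ->
  exists2 m, maximal_ideal m & I `<=` m.
Proof.
move: I; apply: noeth_ind => I hI IH nI.
have [[J [hJ IJ JI nJ]]|noJ] :=
  pselect (exists J, [/\ ideal J, I `<=` J, J <> I & ~ J 1]).
  by have [m hm Jm] := IH J hJ IJ JI nJ; exists m => //; apply: subset_trans Jm.
exists I => //; split=> // J hJ nJ IJ; apply: contrapT => JI.
by apply: noJ; exists J.
Qed.

Lemma maximal_prime m : maximal_ideal m -> prime_ideal m.
Proof.
move=> [hm m1 mmax]; split=> // x y hxy; apply: contrapT => /not_orP[nx ny].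
have h1 : iadd m x 1.
  apply: contrapT => n1; apply: nx; rewrite -(mmax _ (iadd_ideal x hm) n1 (@sub_iadd _ _)).
  exact: mem_iadd.
have [r hr] := h1; apply: ny.
have -> : y = (1 - r * x) * y + r * (x * y) by ring.
by apply: ideal_add => //; [apply: ideal_mulr|apply: ideal_mull].
Qed.

Lemma not_prime I : ideal I -> ~ I 1 -> ~ prime_ideal I ->
  exists a b, [/\ I (a * b), ~ I a & ~ I b].
Proof.
move=> hI n1 nP; apply: contrapT => h; apply: nP; split=> // x y hxy.
by apply: contrapT => /not_orP[nx ny]; apply: h; exists x, y.
Qed.

Lemma iadd_neq I y : ideal I -> ~ I y -> iadd I y <> I.
Proof. by move=> hI ny eI; apply: ny; rewrite -eI; apply: mem_iadd. Qed.
Lemma colon_neq I a b : I (b * a) -> ~ I b -> colon I a <> I.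
Proof. by move=> hab nb eI; apply: nb; rewrite -eI. Qed.

(* Prime filtrations in the form of an induction principle. *)
Lemma devissage (Phi : set R -> Prop) I0 :
  (forall I a, ideal I -> I0 `<=` I -> Phi (colon I a) -> Phi (iadd I a) -> Phi I) ->
  Phi setT -> (forall P, prime_ideal P -> I0 `<=` P -> Phi P) ->
  forall I, ideal I -> I0 `<=` I -> Phi I.
Proof.
move=> step hT hP; apply: noeth_ind => I hI IH I0I.
have [/(ideal_1 hI) ->//|n1] := pselect (I 1).
have [/hP|/(not_prime hI n1)[a [b [hab na nb]]]] := pselect (prime_ideal I); first exact.
apply: (step I a) => //.
  apply: IH; [exact: colon_ideal|exact: sub_colon|by apply: (@colon_neq _ _ b) => //; rewrite mulrC|].
  exact: subset_trans I0I (sub_colon _ hI).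
by apply: IH; [exact: iadd_ideal|exact: sub_iadd|exact: iadd_neq|exact: subset_trans I0I (@sub_iadd _ _)].
Qed.

(* A maximal element among the annihilators of elements of R/J is prime. *)
Lemma exists_assoc J a : ideal J -> ~ J a ->
  exists2 b, ~ J (a * b) & prime_ideal (colon J (a * b)).
Proof.
move=> hJ na.
suff H I : ideal I -> forall b, ~ J (a * b) -> I = colon J (a * b) ->
    exists2 b, ~ J (a * b) & prime_ideal (colon J (a * b)).
  by apply: (H _ (colon_ideal (a * 1) hJ) 1) => //; rewrite mulr1.
move: I; apply: noeth_ind => I hI IH b nb Ib.
have [hP|] := pselect (prime_ideal I); first by exists b => //; rewrite -Ib.
have n1 : ~ I 1 by rewrite Ib /colon /= mul1r.
move=> /(not_prime hI n1)[x [y [hxy nx ny]]].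
have nbx : ~ J (a * (b * x)) by rewrite mulrA mulrC => h; apply: nx; rewrite Ib.
apply: (IH (colon J (a * (b * x))) _ _ _ (b * x) nbx) => //.
- exact: colon_ideal.
- rewrite Ib => z; rewrite /colon /= => h.
  have -> : z * (a * (b * x)) = z * (a * b) * x by ring.
  exact: ideal_mulr.
move=> e; apply: ny; rewrite -e /colon /=.
rewrite Ib in hxy; have -> : y * (a * (b * x)) = x * y * (a * b) by ring.
exact: hxy.
Qed.

End Ideals.

(** * Prime avoidance and local rings *)

Section Avoidance.
Variable R : comNzRingType.
Implicit Types (I J P Q m : set R) (a b y r : R).
Hypothesis R_noeth : noetherian R.

(** A finite list in [S] can be enlarged as long as its span misses an element of [S]; the spans
    increase strictly, so this stops. *)
Lemma lincomb_of_family (S : set R) :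
  exists s : seq R, (forall x, x \in s -> S x) /\ S `<=` @lincomb R R^o s.
Proof.
pose Phi I := forall s : seq R, (forall x, x \in s -> S x) -> I = @lincomb R R^o s ->
  exists t : seq R, (forall x, x \in t -> S x) /\ S `<=` @lincomb R R^o t.
suff H : forall I, ideal I -> Phi I.
  by apply: (H (@lincomb R R^o [::]) _ [::]) => //; apply/ideal_submod/lincomb_submod.
apply: noeth_ind => // I hI IH s hs Is.
have [Ss|/existsNP[x /not_implyP[Sx nx]]] := pselect (S `<=` I).
  by exists s; rewrite -Is.
apply: (IH (@lincomb R R^o (x :: s))) (x :: s) _ _ => //.
- exact/ideal_submod/lincomb_submod.
- by rewrite Is => y; apply: (@lincomb_cons R R^o).
- by move=> e; apply: nx; rewrite -e; apply: (@lincomb_mem R R^o); rewrite mem_head.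
- by move=> y; rewrite inE => /predU1P[->|/hs].
Qed.

Lemma prime_prod (T : eqType) (s : seq T) (F : T -> R) P : prime_ideal P ->
  P (\prod_(i <- s) F i) -> exists2 i, i \in s & P (F i).
Proof.
move=> [hP n1 hM]; elim: s => [|x s IH]; first by rewrite big_nil.
rewrite big_cons => /hM[|/IH[i si Pi]]; first by exists x; rewrite ?mem_head.
by exists i; rewrite // inE si orbT.
Qed.

Lemma ideal_prod (T : eqType) (s : seq T) (F : T -> R) I i : ideal I ->
  i \in s -> I (F i) -> I (\prod_(j <- s) F j).
Proof.
move=> hI; elim: s => // x s IH; rewrite inE big_cons => /predU1P[<- h|/IH h /h].
  exact: ideal_mulr.
exact: ideal_mull.
Qed.

(** If [w] avoids the other primes but lies in [p x], add to it an element of [m] lying in all the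
    others and not in [p x]. It exists because a prime [p i] inside [p x] would equal [p x] and
    contain [w]. *)
Lemma prime_avoidance m (T : eqType) (s : seq T) (p : T -> set R) : ideal m ->
  (forall i, i \in s -> prime_ideal (p i) /\ ~ (m `<=` p i)) ->
  (forall i j, i \in s -> j \in s -> p i `<=` p j -> p i = p j) ->
  exists2 w, m w & forall i, i \in s -> ~ p i w.
Proof.
move=> hm; elim: s => [|x s IH] hp anti; first by exists 0 => //; apply: ideal0.
have [i si|i j si sj|w mw nw] := IH; first by apply: hp; rewrite inE si orbT.
  by apply: anti; rewrite inE ?si ?sj orbT.
have [pw|npw] := pselect (p x w); last first.
  by exists w => // i; rewrite inE => /predU1P[->|/nw].
have [hx /existsNP[v0 /not_implyP[mv0 nv0]]] := hp x (mem_head _ _).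
have wit i : exists z, i \in s -> p i z /\ ~ p x z.
  have [si|] := boolP (i \in s); last by exists 0.
  have : ~ (p i `<=` p x).
    move=> h; apply: (nw i si); rewrite (anti i x) ?inE ?eqxx ?si ?orbT //.
  by move=> /existsNP[z /not_implyP[? ?]]; exists z.
have [z hz] := choice wit.
pose v := v0 * \prod_(i <- s) z i.
have nv : ~ p x v.
  have [_ _ h] := hx; move=> /h[//|/(prime_prod hx)[i si]].
  by have [] := hz i si.
exists (w + v); first by apply: ideal_add => //; apply: ideal_mulr.
move=> i; rewrite inE => /predU1P[->|si] h.
  have [hI _ _] := hx; apply: nv.
  by have -> : v = (w + v) - w; [ring|apply: ideal_sub].
have [[hI _ _] _] := hp i (mem_behead (s := x :: s) si).
apply: (nw i si); have -> : w = (w + v) - v by ring.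
apply: ideal_sub => //; apply: ideal_mull => //.
by apply: (ideal_prod hI si); have [] := hz i si.
Qed.

(* The maximal annihilators of nonzero elements of R/J are finitely many
   primes, whose union is the set of zero divisors. *)
Lemma exists_regular J m : ideal J -> ideal m ->
  (forall a, (forall y, m y -> J (y * a)) -> J a) ->
  exists2 w, m w & forall a, J (w * a) -> J a.
Proof.
move=> hJ hm noann.
pose A := [set a | ~ J a /\ forall b, ~ J b -> colon J a `<=` colon J b ->
                                colon J a = colon J b].
have maxA : forall I, ideal I -> forall a, ~ J a -> I = colon J a ->
    exists2 b, A b & colon J a `<=` colon J b.
  apply: noeth_ind => // I hI IH a na Ia.
  have [Aa|nA] := pselect (A a); first by exists a.
  have [b [nb ab neq]] : exists b, [/\ ~ J b, colon J a `<=` colon J b &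
      colon J a <> colon J b].
    apply: contrapT => h; apply: nA; split=> // b nb ab.
    by apply: contrapT => ne; apply: h; exists b.
  have [|||c Ac bc] := IH (colon J b) _ _ _ b nb erefl.
  - exact: colon_ideal.
  - by rewrite Ia.
  - by rewrite Ia => e; apply: neq.
  - by exists c => //; apply: subset_trans bc.
have primeA a : A a -> prime_ideal (colon J a).
  move=> [na amax]; have [b nab hP] := exists_assoc R_noeth hJ na.
  rewrite (amax (a * b)) // => z; rewrite /colon /= mulrA => h.
  exact: ideal_mulr.
have [s [sA As]] := lincomb_of_family A.
have [i si|i j si sj ij|w mw nw] := @prime_avoidance m _ s (colon J) hm.
- have Ai := sA i si; split; first exact: primeA.
  by move=> h; case: Ai => + _; apply; apply: noann => y /h.
- by have [_] := sA i si; apply=> //; have [] := sA j sj.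
exists w => // a hwa; apply: contrapT => na.
have [b Ab ab] := maxA _ (colon_ideal a hJ) a na erefl.
have wb : J (w * b) by apply: ab.
have pb := primeA b Ab.
(* [b] lies in the span of [s]. If no annihilator of a generator were contained in that of [b], the
   product of elements [z i], each killing its generator but not [b], would kill [b], against
   primality. *)
suff [i si ib] : exists2 i, i \in s & colon J i `<=` colon J b.
  apply: (nw i si); have [_ imax] := sA i si; have [nb _] := Ab.
  by rewrite (imax b).
apply: contrapT => nos.
have wit i : exists z, i \in s -> colon J i z /\ ~ colon J b z.
  have [si|] := boolP (i \in s); last by exists 0.
  have : ~ (colon J i `<=` colon J b) by move=> h; apply: nos; exists i.
  by move=> /existsNP[z /not_implyP[? ?]]; exists z.
have [z hz] := choice wit.
have : colon J b (\prod_(i <- s) z i).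
  have : @lincomb R R^o s b by apply: As.
  suff: @lincomb R R^o s `<=` colon J (\prod_(i <- s) z i).
    by move=> h /h; rewrite /colon /= mulrC.
  apply: (@lincomb_sub R R^o); first exact/ideal_submod/colon_ideal.
  move=> x xs; rewrite /colon /= mulrC; have [zx _] := hz x xs.
  exact: (ideal_prod (colon_ideal x hJ) xs zx).
by move=> /(prime_prod pb)[i si]; have [] := hz i si.
Qed.

End Avoidance.

Section LocalRing.
Variables (R : comNzRingType) (m : set R).
Hypotheses (R_noeth : noetherian R) (R_local : local_ring m).
Implicit Types (I J P : set R).

Lemma m_max : maximal_ideal m. Proof. by case: R_local. Qed.
Lemma m_prime : prime_ideal m. Proof. exact/maximal_prime/m_max. Qed.
Lemma m_ideal : ideal m. Proof. by case: m_max. Qed.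
Lemma m_n1 : ~ m 1. Proof. by case: m_max. Qed.

Lemma proper_sub_m I : ideal I -> ~ I 1 -> I `<=` m.
Proof.
move=> hI nI; have [m' hm' Im'] := exists_maximal_over R_noeth hI nI.
by have [_ /(_ m' hm') <-] := R_local.
Qed.

Lemma prime_sub_m P : prime_ideal P -> P `<=` m.
Proof. by move=> [hP nP _]; apply: proper_sub_m. Qed.

Lemma not_m_unit s : ~ m s -> exists u, u * s = 1.
Proof.
move=> ns; apply: contrapT => nu; apply: ns.
pose I := iadd [set (0 : R)] s.
have hI : ideal I by apply: iadd_ideal; apply: ideal_zero.
apply: (proper_sub_m hI); last by apply: mem_iadd; apply: ideal_zero.
by move=> [r /eqP]; rewrite subr_eq0 => /eqP h; apply: nu; exists r.
Qed.

(* Every proper ideal of this kind is m-primary. *)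
Definition mprimary I : Prop := forall P, prime_ideal P -> I `<=` P -> P = m.

Lemma mprimaryS I J : mprimary I -> I `<=` J -> mprimary J.
Proof. by move=> hI IJ P hP JP; apply: hI => //; apply: subset_trans JP. Qed.

(** Noetherian induction: when [a * b] lies in [I], the product of the larger ideals [iadd I a] and
    [iadd I b] is contained in [I], so their exponents add up. *)
Lemma mprimary_pow I : ideal I -> mprimary I -> exists k, idealX m k `<=` I.
Proof.
move: I; apply: (noeth_ind R_noeth) => I hI IH mI.
have [/(ideal_1 hI) ->|n1] := pselect (I 1); first by exists 0%N.
have [hP|/(not_prime hI n1)[a [b [hab na nb]]]] := pselect (prime_ideal I).
  exists 1%N; apply: smallest_sub => // x [c [hc ->]].
  by rewrite big_ord1 (mI I).
have [k hk] : exists k, idealX m k `<=` iadd I a.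
  apply: IH; [exact: iadd_ideal|exact: sub_iadd|exact: iadd_neq|].
  exact: (mprimaryS mI (@sub_iadd _ _ _)).
have [l hl] : exists k, idealX m k `<=` iadd I b.
  apply: IH; [exact: iadd_ideal|exact: sub_iadd|exact: iadd_neq|].
  exact: (mprimaryS mI (@sub_iadd _ _ _)).
exists (k + l)%N; apply: smallest_sub => // x [c [hc ->]].
rewrite big_split_ord /=.
set u := \prod_(i < k) _; set v := \prod_(i < l) _.
have [r hr] : iadd I a u.
  apply: hk; apply: sub_gen_smallest; exists (fun i => c (lshift l i)); split=> // i.
have [t ht] : iadd I b v.
  by apply: hl; apply: sub_gen_smallest; exists (fun i => c (rshift k i)).
have -> : u * v = (u - r * a) * v + r * a * (v - t * b) + r * t * (a * b) by ring.
apply: ideal_add => //; last exact: ideal_mull.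
by apply: ideal_add => //; [apply: ideal_mulr|apply: ideal_mull].
Qed.

(** An associated prime of R/I contains [I], hence is [m]. *)
Lemma mprimary_socle I : ideal I -> mprimary I -> ~ I 1 ->
  exists2 a, ~ I a & forall y, m y -> I (y * a).
Proof.
move=> hI mI n1; have [b nb hP] := exists_assoc R_noeth hI n1.
exists (1 * b) => // y; rewrite -(mI _ hP); first by [].
exact: sub_colon.
Qed.

End LocalRing.

(** * Linear systems over injective modules *)

Section KernelQuotient.
Variables (R : comNzRingType) (M N : lmodType R) (phi : {linear M -> N}).

Definition ker_pred : {pred M} := [pred x | phi x == 0].

Lemma ker_pred_submod : GRing.submod_closed ker_pred.
Proof.
split; first by rewrite inE linear0.
by move=> a u v; rewrite !inE => /eqP hu /eqP hv; rewrite linearP hu hv scaler0 addr0.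
Qed.

HB.instance Definition _ :=
  GRing.isZmodClosed.Build M ker_pred (GRing.submod_closedB ker_pred_submod).

Lemma ker_predZ : GRing.scaler_closed ker_pred.
Proof. exact: GRing.subsemimod_closedZ ker_pred_submod. Qed.

Lemma ker_lift (E : lmodType R) (g : {linear M -> E}) :
  (forall x, phi x = 0 -> g x = 0) ->
  exists h : {linear quot_module ker_predZ -> E}, forall x, h (quot_class ker_predZ x) = g x.
Proof.
move=> hg; pose h0 (z : quot_module ker_predZ) := g (repr (z : Quotient.quot ker_pred)).
have h0E x : h0 (quot_class ker_predZ x) = g x.
  apply/eqP; rewrite -subr_eq0 -linearB; apply/eqP/hg/eqP.
  suff : repr (quot_class ker_predZ x : Quotient.quot ker_pred) - x \in ker_pred by [].
  by apply/(quot_class_eq ker_predZ); rewrite /quot_class reprK.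
have h0l : linear h0.
  move=> a y z; have [u ->] := quot_classP y; have [v ->] := quot_classP z.
  by rewrite -linearP !h0E linearP.
pose h : {linear quot_module ker_predZ -> E} :=
  HB.pack h0 (GRing.isLinear.Build R _ E _ h0 h0l).
by exists h.
Qed.

End KernelQuotient.

(** Both maps factor through M/ker phi, on which [phi] becomes injective. *)
Lemma injective_extend (R : comNzRingType) (M N E : lmodType R)
    (phi : {linear M -> N}) (g : {linear M -> E}) : injective_module E ->
  (forall x, phi x = 0 -> g x = 0) ->
  exists h : {linear N -> E}, forall x, h (phi x) = g x.
Proof.
move=> hE hg; have [i hi] := @ker_lift R M N phi N phi (fun x h => h).
have [g' hg'] := ker_lift hg.
have [|h hh] := hE _ _ i g'.
  move=> y z; have [u ->] := quot_classP y; have [v ->] := quot_classP z.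
  rewrite !hi => huv; apply/quot_class_eq.
  suff : phi (u - v) == 0 by [].
  by rewrite linearB huv subrr.
by exists h => x; rewrite -hi hh hg'.
Qed.

Section LinearSystems.
Variables (R : comNzRingType).

Section Action.
Variables (K : lmodType R) (k n : nat) (g : 'M[R]_(k, n)).

(** This is Hom(-, K) applied to the map [c |-> c *m g] of free modules. *)
Definition mxact (v : {ffun 'I_n -> K}) : {ffun 'I_k -> K} :=
  [ffun b => \sum_a g b a *: v a].

Lemma mxact_is_linear : linear mxact.
Proof.
move=> c u v; apply/ffunP => b; rewrite !ffunE scaler_sumr -big_split /=.
by apply: eq_bigr => a _; rewrite !ffunE scalerDr !scalerA mulrC.
Qed.

HB.instance Definition _ :=
  GRing.isLinear.Build R _ _ _ mxact mxact_is_linear.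

End Action.

Lemma mxact_mul (K : lmodType R) k n p (g : 'M[R]_(k, n)) (h : 'M_(n, p))
    (v : {ffun 'I_p -> K}) : mxact (g *m h) v = mxact g (mxact h v).
Proof.
apply/ffunP => b; rewrite !ffunE.
transitivity (\sum_a \sum_c (g b c * h c a) *: v a).
  by apply: eq_bigr => a _; rewrite mxE scaler_suml.
rewrite exchange_big; apply: eq_bigr => c _; rewrite ffunE scaler_sumr.
by apply: eq_bigr => a _; rewrite scalerA.
Qed.

Lemma mxact0 (K : lmodType R) k n (v : {ffun 'I_n -> K}) :
  mxact (0 : 'M[R]_(k, n)) v = 0.
Proof. by apply/ffunP => b; rewrite !ffunE big1 // => a _; rewrite mxE scale0r. Qed.

Lemma mxact_map (K L : lmodType R) (d : {linear K -> L}) k n (g : 'M[R]_(k, n))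
    (v : {ffun 'I_n -> K}) :
  mxact g [ffun a => d (v a)] = [ffun b => d (mxact g v b)].
Proof.
apply/ffunP => b; rewrite !ffunE linear_sum; apply: eq_bigr => a _.
by rewrite ffunE linearZ.
Qed.

(** The vector [w] is a map from R^k to [E]. By consistency it kills the kernel of [c |-> c *m g],
    so it extends along this map to R^n; the values on the basis solve the system. *)
Lemma injective_solve (E : lmodType R) k n (g : 'M[R]_(k, n))
    (w : {ffun 'I_k -> E}) : injective_module E ->
  (forall c : 'rV_k, c *m g = 0 -> \sum_b c 0 b *: w b = 0) ->
  exists v, mxact g v = w.
Proof.
move=> hE cons; pose G (c : 'rV[R]_k) := \sum_b c 0 b *: w b.
have Gl : linear G.
  move=> a u v; rewrite /G scaler_sumr -big_split; apply: eq_bigr => b _ /=.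
  by rewrite !mxE scalerDl scalerA.
pose G' : {linear 'rV[R]_k -> E} := HB.pack G (GRing.isLinear.Build R _ _ _ G Gl).
have [h hh] := @injective_extend R _ _ E (mulmxr g : {linear 'rV_k -> 'rV_n}) G' hE cons.
exists [ffun a => h (delta_mx 0 a)]; apply/ffunP => b; rewrite ffunE.
transitivity (h (delta_mx 0 b *m g)).
  rewrite -rowE [row b g]row_sum_delta linear_sum; apply: eq_bigr => a _.
  by rewrite ffunE linearZ mxE.
transitivity (G (delta_mx 0 b)); first exact: hh.
rewrite /G (bigD1 b) //= big1 ?addr0 ?mxE ?eqxx ?scale1r // => c ne.
by rewrite mxE (negbTE ne) andbF scale0r.
Qed.

Lemma lincomb_mulmx k (s : seq 'rV[R]_k) c : lincomb s c ->
  exists c' : 'rV_(size s), c = c' *m (\matrix_(b < size s) s`_b).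
Proof.
set g := \matrix_(b < _) _; pose A := [set c : 'rV[R]_k | exists c', c = c' *m g].
apply: (@lincomb_sub _ _ A); first split.
- by exists 0; rewrite mul0mx.
- by move=> u v [a ->] [b ->]; exists (a + b); rewrite mulmxDl.
- by move=> a u [b ->]; exists (a *: b); rewrite scalemxAl.
- move=> x xs; have ix : (index x s < size s)%N by rewrite index_mem.
  by exists (delta_mx 0 (Ordinal ix)); rewrite -rowE rowK nth_index.
Qed.

Hypothesis R_noeth : noetherian R.

(** Induction on the rank: the first coordinates form an ideal, and the elements with first
    coordinate zero a submodule of smaller rank. *)
Lemma submod_fg k (A : set 'rV[R]_k) : submod A ->
  exists s, (forall x, x \in s -> A x) /\ A `<=` lincomb s.
Proof.
elim: k A => [|k IH] A hA.
  by exists [::]; split=> // x _; apply/rowP => -[].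
pose pr (l : 'rV[R]_(1 + k)) : R^o := l 0 0.
have prl : linear pr by move=> a u v; rewrite /pr !mxE.
pose pr' : {linear 'rV[R]_(1 + k) -> R^o} := HB.pack pr (GRing.isLinear.Build R _ _ _ pr prl).
pose emb : {linear 'rV[R]_k -> 'rV[R]_(1 + k)} := mulmxr (row_mx 0 1%:M).
have [A0 AD AZ] := hA.
have hI : ideal [set r | exists2 l, A l & pr l = r].
  split; first by exists 0; rewrite // /pr mxE.
    by move=> x y [u hu <-] [v hv <-]; exists (u + v); [exact: AD|rewrite /pr mxE].
  by move=> a x [u hu <-]; exists (a *: u); [exact: AZ|rewrite /pr mxE].
have [s0 hs0] := ideal_lincomb R_noeth hI.
have wit r : exists l, r \in s0 -> A l /\ pr l = r.
  have [rs|] := boolP (r \in s0); last by exists 0.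
  have [l ? ?] : [set r | exists2 l, A l & pr l = r] r.
    by rewrite hs0; apply: (@lincomb_mem R R^o).
  by exists l.
have [h hh] := choice wit.
have [|s1 [s1A hs1]] := IH [set l | A (emb l)].
  split=> [|u v hu hv|a u hu] /=; first by rewrite mul0mx.
    by rewrite mulmxDl; apply: AD.
  by rewrite -scalemxAl; apply: AZ.
have sA x : x \in map h s0 ++ map emb s1 -> A x.
  by rewrite mem_cat => /orP[] /mapP[y ys ->]; [have [] := hh y ys|apply: s1A].
exists (map h s0 ++ map emb s1); split=> // l hl.
have prs : @lincomb R R^o s0 (pr l) by rewrite -hs0; exists l.
have [|//|v hv vl] := @lincomb_lift R _ _ pr' h s0 (pr l).
- by move=> x xs; have [] := hh x xs.
have Av : A v.
  by apply: (lincomb_sub hA _ hv) => x /mapP[y ys ->]; have [] := hh y ys.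
pose l' : 'rV[R]_(1 + k) := l - v.
have l'0 : lsubmx l' = 0.
  apply/rowP => i; rewrite !mxE !ord1 lshift0.
  by apply/eqP; rewrite subr_eq0 -[l 0 0]/(pr l) -vl.
have lvE : l - v = emb (rsubmx l').
  by rewrite /= mul_mx_row mulmx0 mulmx1 -l'0 hsubmxK.
rewrite -(subrK v l) addrC; apply: lincomb_cat => //.
rewrite lvE; apply/lincomb_map/hs1; rewrite /= -[A _]/(A (emb _)) -lvE.
exact: submodB.
Qed.

Lemma exists_syzygies k n (g : 'M[R]_(k, n)) : exists p (g' : 'M[R]_(p, k)),
  g' *m g = 0 /\ forall c : 'rV_k, c *m g = 0 -> exists c', c = c' *m g'.
Proof.
have [|s [sA hs]] := @submod_fg k [set c | c *m g = 0].
  split=> [|u v hu hv|a u hu] /=; first by rewrite mul0mx.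
    by rewrite mulmxDl hu hv addr0.
  by rewrite -scalemxAl hu scaler0.
exists (size s), (\matrix_(b < size s) s`_b); split.
  apply/row_matrixP => b; rewrite row_mul rowK row0.
  by apply: sA; rewrite mem_nth.
by move=> c /hs /lincomb_mulmx.
Qed.

Lemma injective_solve_syz (E : lmodType R) k n p (g : 'M[R]_(k, n))
    (g' : 'M[R]_(p, k)) (w : {ffun 'I_k -> E}) : injective_module E ->
  (forall c : 'rV_k, c *m g = 0 -> exists c', c = c' *m g') ->
  mxact g' w = 0 -> exists v, mxact g v = w.
Proof.
move=> hE syz gw; apply: injective_solve => // c /syz[c' cE].
transitivity (mxact c w 0); first by rewrite ffunE.
by rewrite cE mxact_mul gw linear0 ffunE.
Qed.

End LinearSystems.

(** * Ext groups of cyclic modules *)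

Section FfunMap.
Variables (R : comNzRingType) (K L : lmodType R) (d : {linear K -> L}) (n : nat).

Definition ffun_map (v : {ffun 'I_n -> K}) : {ffun 'I_n -> L} := [ffun a => d (v a)].

Lemma ffun_map_is_linear : linear ffun_map.
Proof. by move=> a u v; apply/ffunP => i; rewrite !ffunE linearP. Qed.

HB.instance Definition _ := GRing.isLinear.Build R _ _ _ ffun_map ffun_map_is_linear.

Lemma mxact_ffun_map k (g : 'M[R]_(k, n)) v :
  mxact g (ffun_map v) = [ffun b => d (mxact g v b)].
Proof. exact: mxact_map. Qed.

End FfunMap.

(* For an injective resolution K of R, the group of cocycles modulo
   coboundaries defined below is Ext^i(R/I, R): a homomorphism R/I -> K i is an
   element of K i killed by I. *)
Section Resolution.
Variables (R : comNzRingType) (K : nat -> lmodType R).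
Variables (e : {linear R^o -> K 0}) (delta : forall i, {linear K i -> K i.+1}).
Hypothesis K_inj : forall i, injective_module (K i).
Hypothesis e_inj : injective e.
Hypothesis exact0 : forall z, delta 0 z = 0 <-> exists y, e y = z.
Hypothesis exactS : forall i z, delta i.+1 z = 0 <-> exists y, delta i y = z.
Hypothesis R_noeth : noetherian R.
Implicit Types (I J P Q : set R) (i k n : nat).

Lemma delta_delta i z : delta i.+1 (delta i z) = 0.
Proof. by apply/exactS; exists z. Qed.

(** The solutions of [mxact g v = 0] are the homomorphisms from the cokernel of [c |-> c *m g] to
    [K i]; these are the coboundaries among them. *)
Definition vcobd i k n (g : 'M[R]_(k, n)) : {ffun 'I_n -> K i} -> Prop :=
  if i is j.+1 then fun z => exists2 v, mxact g v = 0 & ffun_map (delta j) v = z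
  else fun z => z = 0.

(** Dimension shifting: for [g'] the syzygies of [g], the cokernel of [g'] is the image of [g], and
    its Ext^i maps onto Ext^(i+1) of the cokernel of [g]. The shift leaves the cyclic modules, hence
    the matrices. In degree zero, Ext is a submodule of a free module. *)
Lemma ext_fg i k n (g : 'M[R]_(k, n)) : exists s : seq {ffun 'I_n -> K i},
  (forall x, x \in s -> mxact g x = 0 /\ ffun_map (delta i) x = 0) /\
  forall v, mxact g v = 0 -> ffun_map (delta i) v = 0 ->
    exists2 b, vcobd g b & lincomb s (v - b).
Proof.
elim: i k n g => [|i IH] k n g.
  pose ev (r : 'rV[R]_n) : {ffun 'I_n -> K 0} := [ffun a => e (r 0 a)].
  have evl : linear ev.
    move=> a u v; apply/ffunP => b; rewrite !ffunE !mxE.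
    exact: (linearP e).
  pose ev' : {linear 'rV[R]_n -> {ffun 'I_n -> K 0}} :=
    HB.pack ev (GRing.isLinear.Build R _ _ _ ev evl).
  have act_ev r b : mxact g (ev r) b = e ((r *m g^T) 0 b).
    rewrite ffunE mxE; transitivity (e (\sum_a g b a *: (r 0 a : R^o))).
      by rewrite linear_sum; apply: eq_bigr => a _; rewrite ffunE linearZ.
    by congr (e _); apply: eq_bigr => a _; rewrite mxE mulrC.
  have [|s [sA hs]] := @submod_fg _ R_noeth n [set r | r *m g^T = 0].
    split=> [|u v hu hv|a u hu] /=; first by rewrite mul0mx.
      by rewrite mulmxDl hu hv addr0.
    by rewrite -scalemxAl hu scaler0.
  exists (map ev s); split=> [x /mapP[r rs ->]|v gv dv].
    split; apply/ffunP => b; first by rewrite act_ev (sA r) // mxE linear0 ffunE.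
    by rewrite !ffunE; apply/exact0; exists (r 0 b).
  exists 0 => //=; rewrite subr0.
  have wit a : exists y, e y = v a.
    by apply/exact0; have := congr1 (fun w : {ffun _ -> _} => w a) dv; rewrite !ffunE.
  have [r hr] := choice wit.
  pose r' : 'rV[R]_n := \row_a r a.
  have <- : ev r' = v by apply/ffunP => a; rewrite ffunE mxE.
  apply/(lincomb_map ev')/hs; apply/rowP => b; rewrite [RHS]mxE.
  apply: e_inj; rewrite -act_ev linear0.
  have -> : ev r' = v by apply/ffunP => a; rewrite ffunE mxE.
  by rewrite gv ffunE.
have [p [g' [gg syz]]] := exists_syzygies R_noeth g.
have [s [sA hs]] := IH _ _ g'.
have solve (w : {ffun 'I_k -> K i}) : mxact g' w = 0 -> exists v, mxact g v = w.
  exact: (injective_solve_syz (@K_inj i) syz).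
have wit (w : {ffun 'I_k -> K i}) : exists v, mxact g' w = 0 -> mxact g v = w.
  have [/solve[v hv]|nw] := pselect (mxact g' w = 0); first by exists v.
  by exists 0.
have [h hh] := choice wit.
exists (map (@ffun_map _ _ _ (delta i) n) (map h s)); split=> [x|v gv dv].
  rewrite -map_comp => /mapP[w ws ->] /=; have [gw dw] := sA w ws.
  split; last by apply/ffunP => a; rewrite !ffunE delta_delta.
  by rewrite mxact_ffun_map hh.
have witv a : exists y, delta i y = v a.
  by apply/exactS; have := congr1 (fun w : {ffun _ -> _} => w a) dv; rewrite !ffunE.
have [t' ht'] := choice witv; pose t := [ffun a => t' a].
have tE : ffun_map (delta i) t = v by apply/ffunP => a; rewrite !ffunE.
have [||b hb lb] := hs (mxact g t).
- by rewrite -mxact_mul gg mxact0.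
- by apply/ffunP => c; have := mxact_ffun_map (delta i) g t; rewrite tE gv => /ffunP/(_ c); rewrite !ffunE.
(* The coboundary [b] lifts to a vector that [delta] kills; subtracting it and [v0] from [t] leaves
   a solution for [g], whose image is the required coboundary. *)
have [b' gb' db'] : exists2 b', mxact g b' = b & ffun_map (delta i) b' = 0.
  case: (i) (b) hb => [|j] b0 /=.
    by move=> ->; exists 0; rewrite linear0.
  move=> [q gq <-].
  have [q' <-] := injective_solve_syz (@K_inj j) syz gq.
  exists (ffun_map (delta j) q'); first by rewrite mxact_ffun_map.
  by apply/ffunP => a; rewrite !ffunE delta_delta.
have [x xs|v0 hv0 gv0] := @lincomb_lift _ _ _ (mxact g : {linear _ -> _}) h s _ _ lb.
  by apply: hh; have [] := sA x xs.
exists (ffun_map (delta i) (t - b' - v0)).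
  by exists (t - b' - v0); rewrite // !linearB /= gb' gv0 subrr.
have -> : ffun_map (delta i) (t - b' - v0) = v - ffun_map (delta i) v0.
  by rewrite linearB linearB /= tE db' [v - 0]subr0.
by rewrite opprB addrC subrK; apply: lincomb_map.
Qed.

Definition killed i I (v : K i) : Prop := forall a, I a -> a *: v = 0.

Definition cocyc i I (z : K i) : Prop := killed I z /\ delta i z = 0.

Definition cobd i I : K i -> Prop :=
  if i is j.+1 then fun z => exists2 v, killed I v & delta j v = z
  else fun z => z = 0.

Lemma killed_submod i I : submod [set v : K i | killed I v].
Proof.
split=> [a _|u v hu hv a ha|c u hu a ha] /=; first by rewrite scaler0.
  by rewrite scalerDr hu // hv // addr0.
by rewrite scalerA mulrC -scalerA hu // scaler0.
Qed.

Lemma killedD i I (u v : K i) : killed I u -> killed I v -> killed I (u + v).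
Proof. by have [_ h _] := killed_submod i I; apply: h. Qed.
Lemma killedZ i I a (u : K i) : killed I u -> killed I (a *: u).
Proof. by have [_ _ h] := killed_submod i I; apply: h. Qed.
Lemma killedB i I (u v : K i) : killed I u -> killed I v -> killed I (u - v).
Proof. exact: submodB (killed_submod i I). Qed.
Lemma killedS i I J (v : K i) : I `<=` J -> killed J v -> killed I v.
Proof. by move=> IJ h a /IJ /h. Qed.
Lemma killed_iadd i I y (v : K i) : killed I v -> y *: v = 0 -> killed (iadd I y) v.
Proof.
move=> hv yv a [r hr]; rewrite -(subrK (r * y) a) scalerDl hv // add0r.
by rewrite -scalerA yv scaler0.
Qed.
Lemma killed_colon i I y (v : K i) : killed I v -> killed (colon I y) (y *: v).
Proof. by move=> hv a ha; rewrite scalerA hv. Qed.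
Lemma killed_delta i I (v : K i) : killed I v -> killed I (delta i v).
Proof. by move=> hv a ha; rewrite -linearZ hv // linear0. Qed.

Lemma cocyc_submod i I : submod [set v : K i | cocyc I v].
Proof.
have [k0 kD kZ] := killed_submod i I; split=> /=.
- by split; [exact: k0|rewrite linear0].
- by move=> u v [ku du] [kv dv]; split; [exact: kD|rewrite linearD /= du dv addr0].
- by move=> a u [ku du]; split; [exact: kZ|rewrite linearZ /= du scaler0].
Qed.

Lemma cobd_submod i I : submod [set v : K i | cobd I v].
Proof.
case: i => [|i] /=; split=> /=.
- by [].
- by move=> u v -> ->; rewrite addr0.
- by move=> a u ->; rewrite scaler0.
- by exists 0; rewrite ?linear0 //; have [] := killed_submod i I.
- move=> u v [u' ku <-] [v' kv <-]; exists (u' + v'); first exact: killedD.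
  by rewrite linearD.
- by move=> a u [u' ku <-]; exists (a *: u'); [exact: killedZ|rewrite linearZ].
Qed.

Lemma cobd0 i I : cobd I (0 : K i).
Proof. by case: (cobd_submod i I). Qed.
Lemma cobdD i I (u v : K i) : cobd I u -> cobd I v -> cobd I (u + v).
Proof. by have [_ h _] := cobd_submod i I; apply: h. Qed.
Lemma cobdZ i I a (u : K i) : cobd I u -> cobd I (a *: u).
Proof. by have [_ _ h] := cobd_submod i I; apply: h. Qed.
Lemma cobdB i I (u v : K i) : cobd I u -> cobd I v -> cobd I (u - v).
Proof. exact: submodB (cobd_submod i I). Qed.
Lemma cobdN i I (u : K i) : cobd I u -> cobd I (- u).
Proof. exact: submodN (cobd_submod i I). Qed.
Lemma cobdS i I J (v : K i) : I `<=` J -> cobd J v -> cobd I v.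
Proof.
by move=> IJ; case: i v => //= i _ [v kv <-]; exists v => //; apply: killedS kv.
Qed.
Lemma cobd_subr i I (u v : K i) : cobd I (u - v) -> cobd I v -> cobd I u.
Proof. by move=> h hv; rewrite -(subrK v u); apply: cobdD. Qed.
Lemma cobd_delta i I (v : K i) : killed I v -> cobd I (delta i v).
Proof. by move=> kv; exists v. Qed.
Lemma cocycS i I J (v : K i) : I `<=` J -> cocyc J v -> cocyc I v.
Proof. by move=> IJ [k d]; split=> //; apply: killedS k. Qed.
Lemma cocycZ i I a (u : K i) : cocyc I u -> cocyc I (a *: u).
Proof. by have [_ _ h] := cocyc_submod i I; apply: h. Qed.
Lemma cocyc_colon i I y (z : K i) : cocyc I z -> cocyc (colon I y) (y *: z).
Proof.
by move=> [k d]; split; [exact: killed_colon|rewrite linearZ /= d scaler0].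
Qed.
Lemma cobd_colon i I y (z : K i) : cobd I z -> cobd (colon I y) (y *: z).
Proof.
case: i z => [|i] z /=; first by move=> ->; rewrite scaler0.
by move=> [u ku <-]; exists (y *: u); [exact: killed_colon|rewrite linearZ].
Qed.

(** Injectivity of [K i] along the embedding of R/(I : y) into R/I by multiplication by [y]: one
    equation for [y], and one for each generator of [I]. *)
Lemma divisible i I y (z : K i) : ideal I -> killed (colon I y) z ->
  exists2 z', killed I z' & y *: z' = z.
Proof.
move=> hI kz; have [s Is] := ideal_lincomb R_noeth hI.
pose g : 'M[R]_(1 + size s, 1) := col_mx (y%:M) (\col_b s`_b).
pose w : {ffun 'I_(1 + size s) -> K i} := [ffun b => if split b is inl _ then z else 0].
have [c cg|v hv] := @injective_solve _ (K i) _ _ g w (@K_inj i).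
  rewrite big_split_ord /= big_ord1 [X in _ + X]big1 ?addr0; last first.
    by move=> b _; rewrite ffunE (unsplitK (inr b)) scaler0.
  rewrite ffunE (unsplitK (inl 0)); apply: kz; rewrite /colon /=.
  have := congr1 (fun M : 'M_1 => M 0 0) cg.
  rewrite mxE big_split_ord big_ord1 col_mxEu !mxE mulr1n /=.
  move=> /eqP; rewrite addr_eq0 => /eqP ->; apply: ideal_opp => //.
  apply: ideal_sum => // b; rewrite col_mxEd mxE; apply: ideal_mull => //.
  by rewrite Is; apply: (@lincomb_mem R R^o); rewrite mem_nth.
exists (v 0).
  have sub : @lincomb R R^o s `<=` [set a | a *: v 0 = 0].
    apply: (@lincomb_sub R R^o); first split=> [|a b ha hb|a b hb] /=.
    - by rewrite scale0r.
    - by rewrite scalerDl ha hb addr0.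
    - by rewrite -scalerA hb scaler0.
    move=> x xs; have ix : (index x s < size s)%N by rewrite index_mem.
    have := congr1 (fun w : {ffun _ -> _} => w (rshift 1 (Ordinal ix))) hv.
    by rewrite !ffunE big_ord1 col_mxEd mxE (unsplitK (inr _)) /= nth_index.
  by move=> a; rewrite Is => /sub.
have := congr1 (fun w : {ffun _ -> _} => w 0) hv.
have -> : (0 : 'I_(1 + size s)) = lshift (size s) 0 by apply/val_inj.
by rewrite !ffunE big_ord1 col_mxEu mxE (unsplitK (inl _)).
Qed.

(** [ext_fg] for the column of generators of [I], which presents R/I. *)
Lemma ext_ideal_fg i I : ideal I -> exists s : seq (K i),
  (forall x, x \in s -> cocyc I x) /\
  forall v, cocyc I v -> exists2 b, cobd I b & lincomb s (v - b).
Proof.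
move=> hI; have [s0 Is0] := ideal_lincomb R_noeth hI.
pose g : 'M[R]_(size s0, 1) := \col_b s0`_b.
have killedE j (v : {ffun 'I_1 -> K j}) : mxact g v = 0 <-> killed I (v 0).
  split=> [gv|kv]; last first.
    apply/ffunP => b; rewrite !ffunE big_ord1 mxE kv // Is0.
    by apply: (@lincomb_mem R R^o); rewrite mem_nth.
  have sub : @lincomb R R^o s0 `<=` [set a | a *: v 0 = 0].
    apply: (@lincomb_sub R R^o); first split=> [|a b ha hb|a b hb] /=.
    - by rewrite scale0r.
    - by rewrite scalerDl ha hb addr0.
    - by rewrite -scalerA hb scaler0.
    move=> x xs; have ix : (index x s0 < size s0)%N by rewrite index_mem.
    have := congr1 (fun w : {ffun _ -> _} => w (Ordinal ix)) gv.
    by rewrite !ffunE big_ord1 mxE /= nth_index.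
  by move=> a; rewrite Is0 => /sub.
pose pr (v : {ffun 'I_1 -> K i}) := v 0.
have prl : linear pr by move=> a u v; rewrite /pr !ffunE.
pose pr' : {linear {ffun 'I_1 -> K i} -> K i} :=
  HB.pack pr (GRing.isLinear.Build R _ _ _ pr prl).
have [s [sA hs]] := ext_fg i g.
exists (map pr s); split=> [x /mapP[v vs ->]|v [kv dv]].
  have [/killedE kv dv] := sA v vs; split=> //.
  by have := congr1 (fun w : {ffun _ -> _} => w 0) dv; rewrite !ffunE.
have [||b hb lb] := hs [ffun _ => v]; first by apply/killedE; rewrite ffunE.
  by apply/ffunP => a; rewrite !ffunE.
exists (b 0).
  case: (i) (b) hb => [|j] b' /=; first by move=> ->; rewrite ffunE.
  by move=> [u /killedE ku <-]; exists (u 0); rewrite ?ffunE.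
by have := lincomb_map pr' lb; rewrite /= /pr !ffunE.
Qed.

(* The long exact sequence of 0 -> R/(I : y) -> R/I -> R/(I + y) -> 0, one
   lemma for each of the three kinds of exactness. *)
Lemma les_mid i I y (z : K i) : ideal I -> cocyc I z -> cobd (colon I y) (y *: z) ->
  exists2 z', cocyc (iadd I y) z' & cobd I (z - z').
Proof.
move=> hI cz; case: i z cz => [|i] z [kz dz] /=.
  by move=> yz; exists z; [split=> //; apply: killed_iadd|exact: subrr].
move=> [v kv dv]; have [v' kv' yv'] := divisible hI kv.
exists (z - delta i v'); last by exists v' => //; rewrite opprB addrC subrK.
split; last by rewrite linearB dz delta_delta subrr.
apply: killed_iadd; first by apply: killedB => //; apply: killed_delta.
by rewrite scalerBr -linearZ /= yv' dv subrr.
Qed.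

Lemma les_left i I y (w : K i) : ideal I -> cocyc (colon I y) w ->
  exists w', [/\ killed I w', y *: w' = w & cocyc (iadd I y) (delta i w')].
Proof.
move=> hI [kw dw]; have [w' kw' yw'] := divisible hI kw.
exists w'; split=> //; split; last exact: delta_delta.
by apply: killed_iadd; [exact: killed_delta|rewrite -linearZ /= yw'].
Qed.

Lemma les_right i I y (v : K i) : ideal I -> killed I v ->
  cobd (colon I y) (y *: v) -> cobd (iadd I y) (delta i v).
Proof.
move=> hI; case: i v => [|i] v kv /=.
  by move=> yv; exists v => //; apply: killed_iadd.
move=> [t kt dt]; have [t' kt' yt'] := divisible hI kt.
exists (v - delta i t'); last by rewrite linearB delta_delta subr0.
apply: killed_iadd; first by apply: killedB => //; apply: killed_delta.
by rewrite scalerBr -linearZ /= yt' dt subrr.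
Qed.

(** * Vanishing of Ext, globally and at a prime *)

Definition vanish i I : Prop := forall z : K i, cocyc I z -> cobd I z.

(** The localization of Ext^i(R/I, R) at [Q] is zero, expressed element by element. *)
Definition vanish_at Q i I : Prop :=
  forall z : K i, cocyc I z -> exists2 s, ~ Q s & cobd I (s *: z).

Lemma vanish_zero i : vanish i.+1 [set 0].
Proof.
move=> z [_ /exactS[y <-]]; apply: cobd_delta => a ->.
by rewrite scale0r.
Qed.

Lemma vanish_right i I y : ideal I ->
  vanish i (colon I y) -> vanish i.+1 I -> vanish i.+1 (iadd I y).
Proof.
move=> hI v1 v2 z hz.
have [v kv dv] := v2 z (cocycS (@sub_iadd _ _ _) hz).
rewrite -dv; apply: les_right => //; apply: v1; split; first exact: killed_colon.
rewrite linearZ /= dv; have [kz _] := hz; apply: kz.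
exact: mem_iadd.
Qed.

Lemma vanish_left i I y : ideal I ->
  vanish i I -> vanish i.+1 (iadd I y) -> vanish i (colon I y).
Proof.
move=> hI v1 v2 w hw; have [w' [kw' <- hdw]] := les_left hI hw.
have [v kv dv] := v2 _ hdw.
have -> : y *: w' = y *: (w' - v).
  by rewrite scalerBr (kv y) ?subr0 //; apply: mem_iadd.
apply: cobd_colon; apply: v1; split; last by rewrite linearB /= dv subrr.
by apply: killedB => //; apply: killedS kv; apply: sub_iadd.
Qed.

Section AtPrime.
Variable Q : set R.
Hypothesis hQ : prime_ideal Q.

Lemma prime_notM a b : ~ Q a -> ~ Q b -> ~ Q (a * b).
Proof. by have [_ _ h] := hQ; move=> na nb /h[]. Qed.

Lemma vanish_at_not_sub i I : ~ (I `<=` Q) -> vanish_at Q i I.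
Proof.
move=> /existsNP[s /not_implyP[Is ns]] z [kz _]; exists s => //.
by rewrite kz //; apply: cobd0.
Qed.

Lemma vanish_at_mid i I y : ideal I ->
  vanish_at Q i (colon I y) -> vanish_at Q i (iadd I y) -> vanish_at Q i I.
Proof.
move=> hI v1 v2 z hz; have [s ns hs] := v1 _ (cocyc_colon y hz).
rewrite scalerA mulrC -scalerA in hs.
have [z' hz' zz'] := les_mid hI (cocycZ s hz) hs.
have [t nt ht] := v2 z' hz'; exists (t * s); first exact: prime_notM.
rewrite -scalerA; apply: cobd_subr (_ : cobd _ (t *: z')).
  by rewrite -scalerBr; apply: cobdZ.
by apply: cobdS ht; apply: sub_iadd.
Qed.

(** In a prime filtration of R/I, the factors R/P with [P] not inside [Q] disappear at [Q]. *)
Lemma vanish_at_devissage i I : ideal I ->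
  (forall P, prime_ideal P -> I `<=` P -> P `<=` Q -> vanish_at Q i P) ->
  vanish_at Q i I.
Proof.
move=> hI hP; apply: (devissage R_noeth (I0 := I)) => //.
- by move=> J a hJ _; apply: vanish_at_mid.
- by apply: vanish_at_not_sub => h; have [_ + _] := hQ; apply; apply: h.
- move=> P pP IP; have [/hP|] := pselect (P `<=` Q); first exact.
  exact: vanish_at_not_sub.
Qed.

(* Nakayama's lemma at Q for the module A/B, by elimination of generators. *)
Lemma nakayama_at (M : lmodType R) (A B : set M) (s : seq M) y :
  submod A -> submod B -> Q y -> (forall x, x \in s -> A x) ->
  (forall v, A v -> exists2 b, B b & lincomb s (v - b)) ->
  (forall v, A v -> exists t a, [/\ ~ Q t, A a & B (t *: v - y *: a)]) ->
  forall v, A v -> exists2 t, ~ Q t & B (t *: v).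
Proof.
move=> sA sB Qy; have [[Q0 _ QM] Q1 _] := hQ.
have [B0 BD BZ] := sB; have [A0 AD AZ] := sA.
suff H : forall s : seq M, (forall x, x \in s -> A x) ->
    (forall v, A v -> exists t b, [/\ ~ Q t, B b & lincomb s (t *: v - b)]) ->
    (forall v, A v -> exists t a, [/\ ~ Q t, A a & B (t *: v - y *: a)]) ->
    forall v, A v -> exists2 t, ~ Q t & B (t *: v).
  move=> hs gen div v Av; apply: (H s) => // u /gen[b Bb lb].
  by exists 1, b; rewrite scale1r.
elim=> [_ gen _ v Av|x {}s IH hs gen div v Av].
  have [t [b [nt Bb /=]]] := gen v Av => /eqP; rewrite subr_eq0 => /eqP tv.
  by exists t; rewrite ?tv.
apply: (IH _ _ div v Av) => [y' ys|u Au]; first by apply: hs; rewrite inE ys orbT.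
have [t1 [a1 [nt1 Aa1 Ba1]]] := div x (hs x (mem_head _ _)).
have [t2 [b2 [nt2 Bb2 [c2 lc2]]]] := gen a1 Aa1.
have [t3 [b3 [nt3 Bb3 [c3 lc3]]]] := gen u Au.
(* Modulo [B], [t1 *: x] is [y *: a1], and [t2 *: a1] is [c2 *: x] plus a combination of [s]; hence
   [d *: x] lies in the span of [s]. As [y] is in [Q], [d] is not. *)
pose d := t1 * t2 - y * c2.
have nd : ~ Q d.
  move=> Qd; apply: (prime_notM nt1 nt2); apply: (ideal_subr _ Qd).
    by have [] := hQ.
  by apply: ideal_mulr => //; have [] := hQ.
pose l2 := t2 *: a1 - b2 - c2 *: x.
pose l3 := t3 *: u - b3 - c3 *: x.
pose b1 := t1 *: x - y *: a1.
exists (d * t3), (d *: b3 + c3 *: (t2 *: b1 + y *: b2)); split.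
- exact: prime_notM.
- by apply: (BD); [exact: BZ|apply: (BZ); apply: (BD); exact: BZ].
have uE : t3 *: u = l3 + c3 *: x + b3 by rewrite /l3 subrK subrK.
have l2E : l2 + b2 = t2 *: a1 - c2 *: x by rewrite /l2 addrAC subrK.
have dE : d *: x = t2 *: b1 + y *: b2 + y *: l2.
  rewrite -addrA -scalerDr [b2 + _]addrC l2E /b1 /d !scalerBr !scalerA scalerBl.
  by rewrite addrA (mulrC y t2) subrK mulrC.
have -> : (d * t3) *: u - (d *: b3 + c3 *: (t2 *: b1 + y *: b2)) =
    d *: l3 + (c3 * y) *: l2.
  rewrite -scalerA uE [d *: (_ + _)]scalerDr opprD addrA addrK.
  rewrite [d *: (_ + _)]scalerDr -addrA; congr (_ + _).
  by rewrite scalerA (mulrC d) -[(c3 * d) *: x]scalerA dE -scalerBr addrAC subrr add0r scalerA.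
by apply: lincombD; apply: lincombZ.
Qed.

(** The connecting map has zero target at [Q], so multiplication by [y] is surjective there on
    Ext^i(R/I, R), and Nakayama's lemma applies. *)
Lemma vanish_at_regular i I y : ideal I -> Q y -> colon I y `<=` I ->
  vanish_at Q i.+1 (iadd I y) -> vanish_at Q i I.
Proof.
move=> hI Qy reg v1; have [s [sA hs]] := ext_ideal_fg i hI.
apply: (nakayama_at (cocyc_submod i I) (cobd_submod i I) Qy sA hs) => v hv.
have [w' [kw' yw' hdw]] := les_left hI (cocycS reg hv).
have [t nt [u ku du]] := v1 _ hdw.
exists t, (t *: w' - u); split=> //=.
  split; last by rewrite linearB linearZ /= du subrr.
  by apply: killedB; [exact: killedZ|apply: killedS ku; apply: sub_iadd].
rewrite scalerBr (ku y) ?subr0; last exact: mem_iadd.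
by rewrite -yw' !scalerA mulrC subrr; apply: cobd0.
Qed.

End AtPrime.

Section ChainStep.
Variables P Q : set R.
Hypotheses (hP : prime_ideal P) (hQ : prime_ideal Q) (PQ : P `<` Q).
Hypothesis sat : forall P', prime_ideal P' -> P `<=` P' -> P' `<=` Q ->
  P' = P \/ P' = Q.

(* Bass: passing to an adjacent smaller prime lowers by one the degree in
   which the localized Ext groups may be nonzero. *)
Lemma vanish_at_chain_step i : vanish_at Q i.+1 Q -> vanish_at P i P.
Proof.
move=> vQ; have [idP _ PM] := hP; have [/existsNP[y /not_implyP[Qy ny]] PQs] :
  ~ (Q `<=` P) /\ P `<=` Q by case: PQ.
suff vP : vanish_at Q i P.
  by move=> z /vP[s ns hs]; exists s => // /PQs.
apply: (vanish_at_regular hQ idP Qy); first by move=> r /PM[].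
(* By [sat], a prime between [iadd P y] and [Q] can only be [Q]. *)
apply: vanish_at_devissage => //; first exact: iadd_ideal.
move=> P' hP' yP' P'Q; have [|//|eP|->//] := @sat P' hP'.
  by apply: subset_trans yP'; apply: sub_iadd.
by case: ny; rewrite -eP; apply/yP'/mem_iadd.
Qed.

End ChainStep.

(** Devissage at [P] would carry the vanishing in degree zero from R/P to R, and some element
    outside [P] would annihilate 1. *)
Lemma not_vanish_minimal P : prime_ideal P ->
  (forall P', prime_ideal P' -> P' `<=` P -> P' = P) -> ~ vanish_at P 0 P.
Proof.
move=> hP Pmin vP.
have v0 : vanish_at P 0 [set 0].
  apply: vanish_at_devissage => //; first exact: ideal_zero.
  by move=> P' hP' _ /(Pmin _ hP') ->.
have [|s ns /= hs] := v0 (e 1).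
  by split; [move=> a ->; rewrite scale0r|apply/exact0; exists 1].
apply: ns; have -> : s = 0; last by have [[]] := hP.
apply: e_inj; rewrite linear0 -hs -linearZ /=.
by congr (e _); rewrite /GRing.scale /= mulr1.
Qed.

(** * Ext of quotients by regular sequences *)

Lemma cobd_iadd i I y (z : K i) : ideal I ->
  (forall j, (j < i)%N -> vanish j (colon I y)) ->
  cocyc (iadd I y) z -> cobd I z -> cobd (iadd I y) z.
Proof.
move=> hI; case: i z => [|i] //= z v1 [kz dz] [v kv vz].
rewrite -vz; apply: les_right => //; apply: v1 => //.
split; first exact: killed_colon.
by rewrite linearZ /= vz kz //; apply: mem_iadd.
Qed.

Lemma vanish_iadd i I y : ideal I -> (forall j, (j < i)%N -> vanish j (colon I y)) ->
  vanish i I -> vanish i (iadd I y).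
Proof.
move=> hI v1 v2 z hz; apply: cobd_iadd => //; apply: v2.
by apply: cocycS hz; apply: sub_iadd.
Qed.

(** Induction on the degree, then on generators: the exact sequence for [iadd I y] involves
    [colon I y], which again contains [J], only in lower degrees. *)
Lemma vanish_sup k J : ideal J -> (forall i, (i < k)%N -> vanish i J) ->
  forall i I, (i < k)%N -> ideal I -> J `<=` I -> vanish i I.
Proof.
move=> hJ vJ i; elim: i {-2}i (leqnn i) => [|n IH] i.
  rewrite leqn0 => /eqP -> I hk; apply: (iadd_ind R_noeth) => // [|{}I y hI JI vI].
    exact: vJ.
  exact: vanish_iadd.
move=> lin I ik; apply: (iadd_ind R_noeth) => // [|{}I y hI JI vI]; first exact: vJ.
apply: vanish_iadd => // j ji; apply: IH; [lia|lia|exact: colon_ideal|].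
exact: subset_trans JI (sub_colon _ hI).
Qed.

(** Since lower Ext groups of cyclic quotients of R/J vanish by [vanish_sup], Ext^k is left exact on
    them. *)
Lemma cobd_sup k J : ideal J -> (forall i, (i < k)%N -> vanish i J) ->
  forall I1 I2 (z : K k), ideal I1 -> J `<=` I1 -> ideal I2 -> I1 `<=` I2 ->
  cocyc I2 z -> cobd I1 z -> cobd I2 z.
Proof.
move=> hJ vJ I1 I2 z hI1 JI1 hI2 I12 + c1; move: I2 hI2 I12.
apply: (iadd_ind R_noeth) => // I y hI I1I IH cz.
have JI := subset_trans JI1 I1I.
apply: cobd_iadd => //; last by apply: IH; apply: cocycS cz; apply: sub_iadd.
move=> j jk; apply: (vanish_sup hJ vJ) => //; first exact: colon_ideal.
exact: subset_trans JI (sub_colon _ hI).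
Qed.

(* J behaves like an ideal generated by a regular sequence of length k:
   Ext^i(R/J, R) is R/J for i = k, and zero otherwise. *)
Definition ext_generator k J (u : K k) : Prop :=
  [/\ cocyc J u, forall r, cobd J (r *: u) <-> J r &
      forall z, cocyc J z -> exists r, cobd J (z - r *: u)].

Definition ext_regular k J : Prop :=
  [/\ ideal J, forall i, i <> k -> vanish i J & exists u, @ext_generator k J u].

Lemma ext_regular0 : ext_regular 0 [set 0].
Proof.
split; first exact: ideal_zero.
  by case=> // i _; apply: vanish_zero.
exists (e 1); split.
- by split=> [a ->|]; [rewrite scale0r|apply/exact0; exists 1].
- move=> r; rewrite -linearZ /=; split=> [|->]; last by rewrite scale0r linear0.
  rewrite -(linear0 e) => /e_inj; rewrite /GRing.scale /= mulr1 => ->.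
  by [].
- move=> z [_ /exact0[y <-]]; exists y; rewrite -linearZ /= -linearB /=.
  by rewrite /GRing.scale /= mulr1 subrr linear0.
Qed.

(** Long exact sequence of multiplication by [w] on R/J. In degree [k] it is injective on Ext^k =
    R/J; in degree [k.+1] the connecting map sends [u] to the new generator [delta k u'], where
    [w *: u' = u]. *)
Lemma ext_regularS k J w : ext_regular k J -> (forall a, J (w * a) -> J a) ->
  ext_regular k.+1 (iadd J w).
Proof.
move=> [hJ vJ [u [cu uJ ugen]]] wreg.
have cJ : colon J w = J.
  apply/seteqP; split; last exact: sub_colon.
  by move=> a; rewrite /colon /= mulrC; apply: wreg.
have hwJ := mem_iadd w hJ.
split; first exact: iadd_ideal.
  move=> i ik1; have [ik|ik] := eqVneq i k; last first.
    case: i ik1 ik => [|i] ik1 ik.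
      by apply: vanish_iadd => //; apply: vJ; apply/eqP.
    apply: vanish_right => //; last by apply: vJ; apply/eqP.
    by rewrite cJ; apply: vJ => e1; apply: ik1; rewrite e1.
  rewrite {}ik => z cz; apply: cobd_iadd => //.
    by move=> j jk; rewrite cJ; apply: vJ; lia.
  have [r hr] := ugen z (cocycS (@sub_iadd _ _ _) cz).
  apply: (cobd_subr hr); apply/uJ/wreg/uJ.
  rewrite -scalerA; have -> : w *: (r *: u) = - (w *: (z - r *: u)).
    by rewrite scalerBr (proj1 cz w hwJ) sub0r opprK.
  by apply: cobdN; apply: cobdZ.
have [|u' [ku' wu' cu']] := @les_left k J w u hJ; first by rewrite cJ.
have [ku du] := cu.
exists (delta k u'); split=> //.
  move=> r; split=> [[v kv dv]|[c hc]].
    have [|c hc] := ugen (r *: u' - v).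
      split; last by rewrite linearB linearZ /= dv subrr.
      by apply: killedB; [exact: killedZ|apply: killedS kv; apply: sub_iadd].
    exists c; apply/uJ.
    have -> : (r - c * w) *: u = w *: (r *: u' - v - c *: u).
      rewrite !scalerBr (kv w) ?subr0; last exact: mem_iadd.
      by rewrite !scalerA (mulrC w r) -[(r * w) *: u']scalerA wu' scalerBl (mulrC w c).
    exact: cobdZ.
  have -> : r *: delta k u' = (r - c * w) *: delta k u'.
    by rewrite scalerBl -scalerA (proj1 cu' w hwJ) scaler0 subr0.
  by rewrite -linearZ /= ku' //; apply: cobd_delta => a _; rewrite scaler0.
have k1 : k.+1 <> k by lia.
move=> z cz; have [v kv dv] := vJ _ k1 z (cocycS (@sub_iadd _ _ _) cz).
have [|r hr] := ugen (w *: v).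
  split; first exact: killedZ.
  by rewrite linearZ /= dv (proj1 cz w hwJ).
have : cobd (iadd J w) (delta k (v - r *: u')).
  apply: les_right => //; first by apply: killedB => //; apply: killedZ.
  by rewrite scalerBr scalerA (mulrC w) -scalerA wu' cJ.
by rewrite linearB linearZ /= dv; exists r.
Qed.

(** Elements of R/J killed by [I] come from Ext^k(R/I, R). On adjoining [y], [les_mid] needs
    [y *: z] to be a coboundary for [colon I y]; by [cobd_sup] this may be tested over [J], where it
    amounts to [J (y * a)]. *)
Lemma ext_regular_ann k J u I a : ideal J -> (forall i, (i < k)%N -> vanish i J) ->
  @ext_generator k J u -> ideal I -> J `<=` I -> (forall r, I r -> J (r * a)) ->
  exists2 z, cocyc I z & cobd J (z - a *: u).
Proof.
move=> hJ vJ [cu uJ _]; move: I; apply: (iadd_ind R_noeth) => //.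
  by move=> _; exists (a *: u); [exact: cocycZ|rewrite subrr; apply: cobd0].
move=> I y hI JI IH ha; have [z cz hz] := IH (fun r Ir => ha r (@sub_iadd _ I y r Ir)).
have yz : cobd (colon I y) (y *: z).
  apply: (cobd_sup hJ vJ hJ) (cocyc_colon y cz) _ => //; first exact: colon_ideal.
    exact: subset_trans JI (sub_colon _ hI).
  apply: cobd_subr (_ : cobd J (y *: (a *: u))).
    by rewrite -scalerBr; apply: cobdZ.
  by rewrite scalerA; apply/uJ/ha/mem_iadd.
have [z' cz' zz'] := les_mid hI cz yz; exists z' => //.
have -> : z' - a *: u = (z - a *: u) - (z - z') by rewrite opprB [RHS]addrC addrA subrK.
by apply: cobdB => //; apply: cobdS zz'.
Qed.

Lemma ext_regular_vanish k J I a : ext_regular k J -> ideal I -> J `<=` I ->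
  vanish k I -> (forall r, I r -> J (r * a)) -> J a.
Proof.
move=> [hJ vJ [u gu]] hI JI vI ha.
have [|z cz hz] := ext_regular_ann hJ _ gu hI JI ha.
  by move=> i ik; apply: vJ; lia.
have [_ uJ _] := gu; apply/uJ.
have -> : a *: u = z - (z - a *: u) by rewrite opprB addrC subrK.
by apply: cobdB => //; apply: cobdS (vI z cz).
Qed.

(* Self-injectivity of R/J, in terms of annihilators. *)
Lemma ext_regular_dual k J I y b : ext_regular k J ->
  (forall L, ideal L -> vanish k.+1 L) -> ideal I -> J `<=` I ->
  (forall r, I (r * y) -> J (r * b)) ->
  exists2 c, (forall r, I r -> J (r * c)) & J (b - y * c).
Proof.
move=> [hJ vJ [u gu]] vtop hI JI hb; have [cu uJ ugen] := gu.
have [|||z [kz dz] hz] := @ext_regular_ann k J u (colon I y) b hJ _ gu (colon_ideal y hI).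
- by move=> i ik; apply: vJ; lia.
- exact: subset_trans JI (sub_colon _ hI).
- exact: hb.
have [w [kw yw cw]] := les_left hI (conj kz dz).
(* The obstruction to choosing [w] as a cocycle lies in Ext^(k+1), which vanishes; [v] corrects [w]
   without changing [y *: w]. *)
have [v kv dv] := vtop _ (iadd_ideal y hI) _ cw.
have czv : cocyc I (w - v).
  split; last by rewrite linearB /= dv subrr.
  by apply: killedB => //; apply: killedS kv; apply: sub_iadd.
have yzv : y *: (w - v) = z.
  by rewrite scalerBr (kv y) ?subr0 //; apply: mem_iadd.
have [c hc] := ugen _ (cocycS JI czv).
exists c => [r Ir|].
  apply/uJ; have -> : (r * c) *: u = - (r *: (w - v - c *: u)).
    by rewrite scalerBr (proj1 czv r Ir) sub0r opprK scalerA.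
  by apply: cobdN; apply: cobdZ.
apply/uJ; have -> : (b - y * c) *: u = y *: (w - v - c *: u) - (z - b *: u).
  by rewrite scalerBr yzv opprB scalerBl -scalerA [RHS]addrC addrA subrK.
by apply: cobdB => //; apply: cobdZ.
Qed.

(** * Bass' and Ischebeck's arguments over the local ring *)

Section Local.
Variables (m : set R) (R_local : local_ring m) (n d : nat).
Hypothesis K_bounded : forall k, (n < k)%N -> forall z : K k, z = 0.
Hypothesis R_dim : krull_dim R d.
Let mP := m_prime R_local.
Let mI := m_ideal R_local.

Lemma vanish_atE i I : vanish_at m i I <-> vanish i I.
Proof.
split=> v z cz; last first.
  by exists 1; [exact: m_n1 R_local|rewrite scale1r; apply: v].
have [s ns hs] := v z cz; have [u us] := not_m_unit R_noeth R_local ns.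
by rewrite -(scale1r z) -us -scalerA; apply: cobdZ.
Qed.

(** A chain of length [d] can be extended neither inside nor at its ends: for [j = 0] and [j = d.+1]
    the lower, respectively upper, inclusion is void. *)
Lemma chain_insert (P : nat -> set R) j P' :
  (forall i, (i <= d)%N -> prime_ideal (P i)) ->
  (forall i, (i < d)%N -> P i `<` P i.+1) -> (j <= d.+1)%N -> prime_ideal P' ->
  (forall i, i.+1 = j -> P i `<` P') -> ((j <= d)%N -> P' `<` P j) -> False.
Proof.
move=> hP sP jd hP' below above.
have [_ /(_ d.+1)] := R_dim; rewrite ltnn => H; suff: false by [].
apply: H; exists (fun i => if (i < j)%N then P i else if i == j then P' else P i.-1).
split=> i id.
  case: ltnP => ij; first by apply: hP; lia.
  by case: eqP => // ne; apply: hP; lia.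
case: (ltngtP i j) => ij.
- case: (ltnP i.+1 j) => i1j; first by apply: sP; lia.
  by have -> : i.+1 == j by [lia]; apply: below; lia.
- have -> : (i.+1 < j)%N = false by lia.
  have -> : (i.+1 == j) = false by lia.
  by case: i id ij => // i id ij /=; apply: sP; lia.
- rewrite ij ltnNge leqnSn /=; have -> : (j.+1 == j) = false by lia.
  by apply: above; lia.
Qed.

(** A chain of length [d] starts at a minimal prime, ends at [m] and is saturated. Along it
    [vanish_at_chain_step] would carry vanishing at [m] down to degree zero at the minimal prime. *)
Lemma not_vanish_dim : ~ vanish d m.
Proof.
have [[P [hP sP]] _] := R_dim.
have Pd : P d = m.
  apply: contrapT => ne; apply: (chain_insert hP sP (leqnn _) mP); last by rewrite ltnn.
  move=> i [->]; split; first exact/(prime_sub_m R_noeth R_local)/hP.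
  move=> h; apply: ne; apply/seteqP; split=> //.
  exact/(prime_sub_m R_noeth R_local)/hP.
move=> /vanish_atE; rewrite -[X in vanish_at X]Pd -Pd => vd.
have {}vd : vanish_at (P d) d (P d) by rewrite Pd in vd *.
have v k : (k <= d)%N -> vanish_at (P (d - k)%N) (d - k) (P (d - k)%N).
  elim: k => [|k IH] kd; first by rewrite subn0.
  have e1 : (d - k = (d - k.+1).+1)%N by lia.
  apply: (@vanish_at_chain_step _ (P (d - k)%N)) => [||||]; last 1 first.
  - by rewrite -e1; apply: IH; lia.
  - by apply: hP; lia.
  - by apply: hP; lia.
  - by rewrite e1; apply: sP; lia.
  move=> P' hP' PP' P'P; apply: contrapT => /not_orP[ne1 ne2].
  apply: (@chain_insert P (d - k) P') => // [|i|_]; first by lia.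
  - rewrite e1 => -[->]; split=> // h; apply: ne1.
    exact/seteqP.
  - by split=> // h; apply: ne2; apply/seteqP.
have := v d (leqnn d); rewrite subnn; apply: not_vanish_minimal; first exact: hP.
move=> P' hP' P'P; apply: contrapT => ne.
apply: (@chain_insert P 0 P') => // _; split=> // h.
by apply: ne; apply/seteqP.
Qed.

(** Descending induction on [i], starting beyond the length [n] of the resolution. Devissage leaves
    primes; for [P] other than [m], an element of [m] outside [P] is regular modulo [P], and
    [vanish_at_regular] passes to degree [i.+1]. *)
Lemma vanish_above t : (forall i, (t < i)%N -> vanish i m) ->
  forall i I, (t < i)%N -> ideal I -> vanish i I.
Proof.
move=> vm i I ti; have [l] := ubnP (n.+1 - i)%N.
elim: l i ti I => // l IH i ti I hl hI; apply/vanish_atE.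
have [/K_bounded K0|ni] := ltnP n i.
  by move=> z _; exists 1; [exact: m_n1 R_local|rewrite (K0 (1 *: z)); apply: cobd0].
apply: (vanish_at_devissage mP) => // P hP _ Pm; have [idP _ PM] := hP.
have [->|ne] := pselect (P = m); first exact/vanish_atE/vm.
have [y [my ny]] : exists y, m y /\ ~ P y.
  apply: contrapT => h; apply: ne; apply/seteqP; split=> // y my.
  by apply: contrapT => ny; apply: h; exists y.
apply: (vanish_at_regular mP idP my); first by move=> r /PM[].
by apply/vanish_atE/IH; [lia|lia|exact: iadd_ideal].
Qed.

(** While Ext^k(R/m, R) vanishes, [m] kills no nonzero element of R/J, so [m] contains an element
    regular modulo [J]. *)
Lemma exists_ext_regular k : (forall i, (i < k)%N -> vanish i m) ->
  exists2 J, ext_regular k J & J `<=` m.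
Proof.
elim: k => [|k IH] vm.
  by exists [set 0]; [exact: ext_regular0|move=> _ ->; apply: ideal0 mI].
have [|J rJ Jm] := IH; first by move=> i ik; apply: vm; lia.
have [hJ _ _] := rJ.
have [w mw wreg] : exists2 w, m w & forall a, J (w * a) -> J a.
  apply: (exists_regular R_noeth hJ mI) => a ha.
  by apply: (ext_regular_vanish rJ mI Jm) => //; apply: vm.
exists (iadd J w); first exact: ext_regularS.
exact: (iadd_sub mI).
Qed.

(* If Ext^s(R/m, R) and Ext^t(R/m, R) are the lowest and the highest nonzero
   ones, then R/m embeds in R/J for an ideal J generated by a regular sequence
   of length s, and right exactness in degree t makes Ext^t(R/J, R) nonzero. *)
Lemma not_vanish_unique s t : ~ vanish s m -> (forall i, (i < s)%N -> vanish i m) ->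
  ~ vanish t m -> (forall i, (t < i)%N -> vanish i m) -> ~ (s < t)%N.
Proof.
move=> ns vs nt vt st; have [J [hJ vJ [u gu]] Jm] := exists_ext_regular vs.
have vJs i : (i < s)%N -> vanish i J by move=> ik; apply: vJ; lia.
have [cu uJ ugen] := gu.
have [z [cz nz]] : exists z : K s, cocyc m z /\ ~ cobd m z.
  apply: contrapT => h; apply: ns => z cz; apply: contrapT => nz.
  by apply: h; exists z.
have [a ha] := ugen z (cocycS Jm cz).
have na : ~ J a.
  move=> /uJ au; apply: nz; apply: (cobd_sup hJ vJs hJ) => //.
  exact: (cobd_subr ha).
have ma : colon J a = m.
  apply/seteqP; split.
    apply: (proper_sub_m R_noeth R_local); first exact: colon_ideal.
    by rewrite /colon /= mul1r.
  move=> r mr; apply/uJ; have -> : (r * a) *: u = - (r *: (z - a *: u)).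
    by rewrite scalerBr (proj1 cz r mr) sub0r opprK scalerA.
  by apply: cobdN; apply: cobdZ.
apply: nt; rewrite -ma; apply: vanish_left => //; first by apply: vJ; lia.
by apply: (vanish_above vt) => //; apply: iadd_ideal.
Qed.

(** The lowest and the highest nonvanishing degrees enclose [d], and they coincide by
    [not_vanish_unique]. *)
Lemma vanish_neq_dim i : i <> d -> vanish i m.
Proof.
pose p i := ~~ `[< vanish i m >].
have pP j : reflect (~ vanish j m) (p j) by apply: (iffP idP) => /asboolPn.
have ex : exists j, p j by exists d; apply/pP/not_vanish_dim.
have bound j : p j -> (j <= n)%N.
  move=> /pP nv; rewrite leqNgt; apply/negP => nj; apply: nv => z _.
  by rewrite (K_bounded nj z); apply: cobd0.
have [s /pP ns smin] := ex_minnP ex.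
have [t /pP nt tmax] := ex_maxnP ex bound.
have vs j : (j < s)%N -> vanish j m.
  by move=> js; apply: contrapT => /pP/smin; lia.
have vt j : (t < j)%N -> vanish j m.
  by move=> js; apply: contrapT => /pP/tmax; lia.
have := not_vanish_unique ns vs nt vt.
have /pP pd := not_vanish_dim; have := smin d pd; have := tmax d pd.
move=> dt sd st id; apply: contrapT => /pP pi.
by have := smin i pi; have := tmax i pi; lia.
Qed.

Lemma vanish_gt_dim i I : (d < i)%N -> ideal I -> vanish i I.
Proof. by apply: vanish_above => j dj; apply: vanish_neq_dim; lia. Qed.

(* Ischebeck's theorem, with dim R/I bounded by the number of elements that
   complete I to an m-primary ideal. *)
Lemma vanish_lt_codim (s : seq R) i I : ideal I -> (forall y, y \in s -> m y) ->
  (forall P, prime_ideal P -> I `<=` P -> (forall y, y \in s -> P y) -> P = m) ->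
  (i + size s < d)%N -> vanish i I.
Proof.
move=> hI; elim: s i I hI => [|y s IH] i I hI ms prim id.
  apply/vanish_atE/(vanish_at_devissage mP) => // P hP IP _.
  by rewrite (prim P hP IP) //; apply/vanish_atE/vanish_neq_dim; lia.
have ms' z : z \in s -> m z by move=> zs; apply: ms; rewrite inE zs orbT.
have my : m y by apply: ms; rewrite mem_head.
move: I hI prim; apply: (noeth_ind R_noeth) => I hI IHI prim.
have prim' J : I `<=` J -> forall P, prime_ideal P -> J `<=` P ->
    (forall z, z \in y :: s -> P z) -> P = m.
  by move=> IJ P hP JP; apply: prim => //; apply: subset_trans JP.
have [Iy|ny] := pselect (I y).
  apply: IH => // [P hP IP sP|]; last by move: id => /=; lia.
  by apply: prim => // z; rewrite inE => /predU1P[->|/sP//]; apply: IP.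
(* A regular [y] moves from the list into the ideal while the degree rises by one. Otherwise
   [colon I y] and [iadd I y] are both strictly larger than [I], and Noetherian induction
   applies. *)
have [reg|/existsNP[a /not_implyP[ya na]]] := pselect (colon I y `<=` I).
  apply/vanish_atE/(vanish_at_regular mP hI my reg)/vanish_atE.
  apply: IH => // [|P hP IP sP|]; [exact: iadd_ideal| |by move: id => /=; lia].
  apply: (prim' _ (@sub_iadd _ I y)) => // z; rewrite inE => /predU1P[->|/sP//].
  exact/IP/mem_iadd.
apply/vanish_atE/(vanish_at_mid mP hI (y := y)); apply/vanish_atE/IHI.
- exact: colon_ideal.
- exact: sub_colon.
- exact: (colon_neq ya).
- exact: (prim' _ (sub_colon _ hI)).
- exact: iadd_ideal.
- exact: sub_iadd.
- exact: iadd_neq.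
- exact: (prim' _ (@sub_iadd _ _ _)).
Qed.

Section SystemOfParams.
Variable s : seq R.
Hypotheses (s_size : size s = d) (s_m : forall y, y \in s -> m y).
Hypothesis s_prim : forall P, prime_ideal P -> (forall y, y \in s -> P y) -> P = m.

(** The annihilator of [a] modulo the ideal of [s2] contains [x], so [s1] alone completes it to an
    m-primary ideal. Then [vanish_lt_codim] applies in degree [size s2], and [ext_regular_vanish]
    gives the claim. *)
Lemma parameters_step s1 x s2 a : s = s1 ++ x :: s2 ->
  ext_regular (size s2) (@lincomb R R^o s2) ->
  @lincomb R R^o s2 (x * a) -> @lincomb R R^o s2 a.
Proof.
move=> sE rJ xa; have [hJ _ _] := rJ.
apply: (ext_regular_vanish rJ (colon_ideal a hJ) (sub_colon _ hJ)) => //.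
apply: (@vanish_lt_codim s1); first exact: colon_ideal.
- by move=> y ys; apply: s_m; rewrite sE mem_cat ys.
- move=> P hP JP s1P; apply: s_prim => // y; rewrite sE mem_cat inE.
  move=> /or3P[/s1P//|/eqP->|ys]; first by apply: JP.
  by apply/JP/(sub_colon _ hJ); apply: (@lincomb_mem R R^o).
- by rewrite -s_size sE size_cat /=; lia.
Qed.

Lemma parameters_ext_regular s1 s2 : s = s1 ++ s2 ->
  ext_regular (size s2) (@lincomb R R^o s2).
Proof.
elim: s2 s1 => [|x s2 IH] s1 sE; first exact: ext_regular0.
have rJ : ext_regular (size s2) (@lincomb R R^o s2).
  by apply: (IH (rcons s1 x)); rewrite sE cat_rcons.
by apply: (@ext_regularS _ (@lincomb R R^o s2) x) => // a; apply: parameters_step sE rJ.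
Qed.

Lemma parameters_regular s1 x s2 a : s = s1 ++ x :: s2 ->
  @lincomb R R^o s2 (x * a) -> @lincomb R R^o s2 a.
Proof.
move=> sE; apply: (parameters_step sE).
by apply: (@parameters_ext_regular (rcons s1 x)); rewrite sE cat_rcons.
Qed.

Lemma parameters_dual I y b : ideal I -> @lincomb R R^o s `<=` I ->
  (forall r, I (r * y) -> @lincomb R R^o s (r * b)) ->
  exists2 c, (forall r, I r -> @lincomb R R^o s (r * c)) &
             @lincomb R R^o s (b - y * c).
Proof.
apply: ext_regular_dual; first exact: (@parameters_ext_regular [::]).
by move=> L hL; apply: vanish_gt_dim => //; rewrite s_size.
Qed.

End SystemOfParams.
End Local.
End Resolution.

(** * Extension of linear maps and top Cech cohomology *)

Section BaerExtension.
Variables (R : comNzRingType) (G E : lmodType R) (q : nat -> set R).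
Implicit Types (X : set (G * E)) (I : set R).

(** For nonempty [X], the graph of a linear map from a submodule of [G] to [E]. *)
Definition partial_linear X : Prop :=
  (forall a u v, X u -> X v -> X (a *: u + v)) /\ forall x, X (0, x) -> x = 0.

Hypothesis torsion : forall g : G, exists n, forall a, q n a -> a *: g = 0.
Hypothesis baer : forall n I (h : R -> E), ideal I -> q n `<=` I ->
  (forall a r t, I r -> I t -> h (a * r + t) = a *: h r + h t) ->
  (forall r, q n r -> h r = 0) -> exists x, forall r, I r -> h r = r *: x.

Lemma partial_linear_fun X g x y : partial_linear X -> X (g, x) -> X (g, y) -> x = y.
Proof.
move=> [lX X0] gx gy; apply/eqP; rewrite -subr_eq0; apply/eqP/X0.
have := lX (-1) _ _ gy gx; congr X; congr pair.
  by rewrite /= scaleN1r addNr.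
by rewrite /= scaleN1r addrC.
Qed.

(** The [r] with [r *: g] in the domain form an ideal, on which [baer] makes the partial map
    multiplication by some [x0]; then [g] can be sent to [x0]. *)
Lemma partial_linear_step X g : partial_linear X -> X (0, 0) ->
  (forall x, ~ X (g, x)) -> exists Y, partial_linear Y /\ X `<` Y.
Proof.
move=> pX X00 ng; have [lX X0] := pX.
pose I := [set r | exists x, X (r *: g, x)].
have XZ a r x : X (r *: g, x) -> X ((a * r) *: g, a *: x).
  move=> h; have := lX a _ _ h X00; congr X; congr pair => /=; rewrite addr0 //.
  by rewrite scalerA.
have XD r t x y : X (r *: g, x) -> X (t *: g, y) -> X ((r + t) *: g, x + y).
  move=> hx hy; have := lX 1 _ _ hx hy; congr X; congr pair => /=; rewrite scale1r //.
  by rewrite scalerDl.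
have hI : ideal I.
  split; first by exists 0; rewrite scale0r.
    by move=> r t [x hx] [y hy]; exists (x + y); apply: XD.
  by move=> a r [x hx]; exists (a *: x); apply: XZ.
have wit (r : R) : exists x : E, I r -> X (r *: g, x).
  by have [[x hx]|nI] := pselect (I r); [exists x|exists 0].
have [h hh] := choice wit.
have [n qg] := torsion g.
have [|a r t Ir It|r qr|x0 hx0] := @baer n I h hI.
- by move=> r /qg e; exists 0; rewrite e.
- apply: (partial_linear_fun pX (hh _ _)); last by apply/XD/hh => //; apply/XZ/hh.
  by apply: ideal_add => //; apply: ideal_mull.
- have := hh r; rewrite qg // => /(_ _)/X0; apply.
  by exists 0; rewrite qg.
pose Y := [set p | exists t, X (p - t *: (g, x0))].
exists Y; split; first split.
- move=> a u v [t ht] [t' ht']; exists (a * t + t').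
  have := lX a _ _ ht ht'; congr X.
  by rewrite scalerDl opprD addrACA scalerBr scalerA.
- move=> x [t ht]; have It : I (- t).
    by exists (x - t *: x0); move: ht; congr X; congr pair; rewrite /= sub0r scaleNr.
  have e1 : X ((- t) *: g, x - t *: x0).
    by move: ht; congr X; congr pair; rewrite /= sub0r scaleNr.
  have := partial_linear_fun pX e1 (hh _ It).
  by rewrite hx0 // scaleNr => /(canRL (subrK _)) ->; rewrite addNr.
split; first by move=> p Xp; exists 0; rewrite scale0r subr0.
move=> YX; apply: (ng x0); apply: YX; exists 1.
by rewrite scale1r subrr.
Qed.

(** Baer's criterion through Zorn's lemma. Testing ideals that contain some [q n] suffices because
    every element to be added to the domain is killed by some [q n]. *)
Lemma baer_extend (g0 : G) (x0 : E) : (forall r, r *: g0 = 0 -> r *: x0 = 0) ->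
  exists psi : {linear G -> E}, psi g0 = x0.
Proof.
move=> hx0; pose P X := X = set0 \/ [/\ partial_linear X, X (0, 0) & X (g0, x0)].
have [|X [PX maxX]] := @Zorn_bigcup _ P.
  move=> F FP tot.
  have [[X0 FX0 [p0 Xp0]]|no] := pselect (exists2 X, F X & exists p, X p); last first.
    by left; apply/seteqP; split=> // p [X FX Xp]; apply: no; exists X => //; exists p.
  have good X p : F X -> X p -> [/\ partial_linear X, X (0, 0) & X (g0, x0)].
    by move=> FX Xp; have [X_0|//] := FP X FX; move: Xp; rewrite X_0.
  right; have [_ X00 Xg] := good X0 p0 FX0 Xp0.
  split; [split|by exists X0|by exists X0].
    move=> a u v [X FX Xu] [Y FY Yv].
    have [XY|YX] := tot _ _ FX FY.
      by exists Y => //; have [[lY _] _ _] := good Y v FY Yv; apply: lY => //; apply: XY.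
    by exists X => //; have [[lX _] _ _] := good X u FX Xu; apply: lX => //; apply: YX.
  by move=> x [X FX Xx]; have [[_ h] _ _] := good X _ FX Xx; apply: h.
have [eX|[pX X00 Xg0]] := PX.
  pose Y := [set p | exists r, p = (r *: g0, r *: x0)].
  case: (maxX Y).
    rewrite eX; split; first by [].
    by move=> /(_ (0, 0)); apply; exists 0; rewrite !scale0r.
  right; split; [split| |].
  - move=> a _ _ [r ->] [t ->]; exists (a * r + t).
    by congr pair; rewrite /= scalerDl scalerA.
  - by move=> x [r [/esym/hx0 h ->]].
  - by exists 0; rewrite !scale0r.
  - by exists 1; rewrite !scale1r.
have tot g : exists x, X (g, x).
  apply: contrapT => ng; have [|Y [pY XY]] := @partial_linear_step X g pX X00.
    by move=> x hx; apply: ng; exists x.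
  by apply: (maxX Y XY); right; split=> //; apply: (proj1 XY).
have [psi hpsi] := choice tot.
have psil : linear psi.
  move=> a u v; apply: (partial_linear_fun pX (hpsi _)).
  by have [lX _] := pX; apply: lX (hpsi u) (hpsi v).
exists (HB.pack psi (GRing.isLinear.Build R G E _ psi psil) : {linear G -> E}) => /=.
exact: (partial_linear_fun pX (hpsi _)).
Qed.

End BaerExtension.

(** * Fractions in top Cech cohomology *)

Section CechClasses.
Variables (R : comNzRingType) (d : nat) (x : 'I_d -> R).
Local Notation y := (\prod_j x j).

(* The class of u / (x_1 ... x_d)^n *)
Definition cfrac (M : lmodType R) (u : M) (n : nat) : cech_top x M :=
  cech_class (frac y u n).

Section Module.
Variable M : lmodType R.
Implicit Types (u v : M) (n k : nat).

Lemma cfracP (c : cech_top x M) : exists u n, c = cfrac u n.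
Proof.
by have [w ->] := cech_classP c; have [u [n ->]] := fracP w; exists u, n.
Qed.

Lemma cfrac_linear n a u v : cfrac (a *: u + v) n = a *: cfrac u n + cfrac v n.
Proof. by rewrite /cfrac fracDl -fracZ /cech_class linearP. Qed.

Lemma cfrac0 n : cfrac (0 : M) n = 0.
Proof. by rewrite /cfrac frac0 /cech_class linear0. Qed.

Lemma cfracZ n a u : a *: cfrac u n = cfrac (a *: u) n.
Proof. by rewrite -[a *: u]addr0 cfrac_linear cfrac0 addr0. Qed.

Lemma cfrac_expand u n k : cfrac (y ^+ k *: u) (k + n) = cfrac u n.
Proof. by rewrite /cfrac frac_expand. Qed.

(** After cancelling [x i ^+ n] the denominator no longer involves [x i], so the fraction is a
    coboundary; the sign in the witness undoes that of the differential. *)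
Lemma cfrac_kill i u n : x i ^+ n *: cfrac u n = 0.
Proof.
rewrite cfracZ -(cfrac0 0); apply/cech_class_eq.
exists (fun j => if j == i then (-1) ^+ i *: frac _ u n else 0).
rewrite frac0 subr0 /cech_diff [RHS](bigD1 i) //= eqxx [X in _ + X]big1 ?addr0.
  by rewrite linearZ /= scalerA -expr2 sqrr_sign scale1r cech_resE.
by move=> j /negbTE ->; rewrite linear0 scaler0.
Qed.

End Module.

Lemma cech_map_cfrac (M N : lmodType R) (phi : {linear M -> N}) u n :
  @cech_map _ _ x _ _ phi (cfrac u n) = cfrac (phi u) n.
Proof. by rewrite /cfrac cech_mapE loc_mapE. Qed.

Definition pow_gens (alpha : 'I_d -> nat) : seq R := [seq x i ^+ alpha i | i <- enum 'I_d].
Definition pow_ideal (alpha : 'I_d -> nat) : set R := @lincomb R R^o (pow_gens alpha).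

Lemma eq_pow_ideal alpha beta : alpha =1 beta -> pow_ideal alpha = pow_ideal beta.
Proof. by move=> /funext ->. Qed.

Lemma pow_ideal_ideal alpha : ideal (pow_ideal alpha).
Proof. exact/ideal_submod/lincomb_submod. Qed.

Lemma pow_ideal_mem alpha i : pow_ideal alpha (x i ^+ alpha i).
Proof. by apply: (@lincomb_mem R R^o); apply: map_f; rewrite mem_enum. Qed.

Lemma pow_ideal_sub alpha I : ideal I -> (forall i, I (x i ^+ alpha i)) ->
  pow_ideal alpha `<=` I.
Proof.
move=> hI hx; apply: (@lincomb_sub R R^o); first exact/ideal_submod.
by move=> _ /mapP[i _ ->].
Qed.

Lemma cfrac_pow_ideal (M : lmodType R) (u : M) n a :
  pow_ideal (fun=> n) a -> a *: cfrac u n = 0.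
Proof.
apply: (pow_ideal_sub (I := [set a | a *: cfrac u n = 0])); last first.
  by move=> i; apply: cfrac_kill.
split=> [|b c hb hc|b c hc] /=; first by rewrite scale0r.
  by rewrite scalerDl hb hc addr0.
by rewrite -scalerA hc scaler0.
Qed.

(** Over a common denominator exponent [k], multiplication by [y ^+ (l + n)] turns each summand of
    the coboundary into a multiple of [x i ^+ (l + k + n)]. *)
Lemma cfrac_eq0 (r : R^o) n : cfrac r n = 0 ->
  exists k, pow_ideal (fun=> k + n)%N (y ^+ k * r).
Proof.
rewrite -(cfrac0 _ 0) => /cech_class_eq[z]; rewrite frac0 subr0 /cech_diff => rz.
have wit (i : 'I_d) : exists u : R^o * nat, z i = frac _ u.1 u.2.
  by have [u [k ->]] := fracP (z i); exists (u, k).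
have [u zu] := choice wit.
pose k := (\sum_i (u i).2)%N.
have uk i : ((u i).2 <= k)%N by rewrite /k (bigD1 i) //= leq_addr.
pose w i : R^o := (\prod_(j | j != i) x j) ^+ (k - (u i).2) *: (u i).1.
have zw i : z i = frac _ (w i) k.
  by rewrite zu -(frac_expand _ _ _ (k - (u i).2)) subnK.
have {}rz : frac y r n = frac y (\sum_(i < d) (-1) ^+ i *: (x i ^+ k *: w i)) k.
  rewrite rz; pose F (v : R^o) := frac y v k.
  rewrite -[RHS]/(F _) (big_morph F (id1 := 0) (op1 := +%R)).
  - by apply: eq_bigr => i _; rewrite zw cech_resE fracZ.
  - by move=> a b; apply: fracDl.
  - exact: frac0.
have [l hl] := (frac_eqP _ _ _ _ _).1 rz.
exists (l + k)%N; rewrite -[_ * r]/(_ *: r) hl scaler_sumr.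
have hq := pow_ideal_ideal (fun=> l + k + n)%N.
apply: (ideal_sum _ hq) => i; rewrite /GRing.scale /= (cech_prodE x i).
have -> : (x i * \prod_(j | j != i) x j) ^+ (l + n) * ((-1) ^+ i * (x i ^+ k * w i)) =
    ((\prod_(j | j != i) x j) ^+ (l + n) * (-1) ^+ i * w i) * x i ^+ (l + k + n).
  by rewrite exprMn !exprD; ring.
by apply: ideal_mull => //; apply: pow_ideal_mem.
Qed.

End CechClasses.

(** * Parameters in a Gorenstein ring *)

Section GorensteinParameters.
Variables (R : comNzRingType) (m : set R) (d : nat).
Hypotheses (R_noetherian : noetherian R) (R_local : local_ring m).
Hypotheses (R_dim : krull_dim R d) (R_gorenstein : gorenstein R).
Variable x : 'I_d -> R.
Hypothesis x_par : parameters m x.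
Local Notation y := (\prod_j x j).
Local Notation qn n := (pow_ideal x (fun=> n)).

Lemma params_prime P : prime_ideal P -> (forall i, P (x i)) -> P = m.
Proof.
move=> hP xP; have : zero_locus (range x) P by split=> // _ [i _ <-].
rewrite x_par => -[_ mP]; apply/seteqP; split=> //.
exact: (prime_sub_m R_noetherian R_local hP).
Qed.

Lemma params_m i : m (x i).
Proof.
have : zero_locus m m by split=> //; apply: (m_prime R_local).
by rewrite -x_par => -[_]; apply; exists i.
Qed.

Lemma prime_pow (P : set R) a n : prime_ideal P -> P (a ^+ n) -> P a.
Proof.
move=> [_ n1 hM]; elim: n => [|n IH]; first by rewrite expr0.
by rewrite exprS => /hM[].
Qed.

Lemma m_pow a n : (0 < n)%N -> m a -> m (a ^+ n).
Proof. by case: n => // n _ ma; rewrite exprS; apply: ideal_mulr (m_ideal R_local) ma. Qed.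

Lemma pow_ideal_m alpha : (forall j, 0 < alpha j)%N -> pow_ideal x alpha `<=` m.
Proof.
move=> pos; apply: pow_ideal_sub; first exact: (m_ideal R_local).
by move=> i; apply: m_pow => //; apply: params_m.
Qed.

Lemma pow_ideal_mprimary alpha : mprimary m (pow_ideal x alpha).
Proof.
move=> P hP qP; apply: params_prime => // i; apply: (prime_pow hP).
exact/qP/pow_ideal_mem.
Qed.

(** The hypothesis puts [x i ^+ k * (r - c * x i ^+ alpha i)] in the ideal of the other powers. With
    these, [x i ^+ k] again forms a system of parameters, so it can be cancelled. *)
Lemma pow_regular alpha beta i k r : (forall j, 0 < alpha j)%N ->
  (forall j, j != i -> beta j = alpha j) -> beta i = (alpha i + k)%N ->
  pow_ideal x beta (x i ^+ k * r) -> pow_ideal x alpha r.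
Proof.
(* For [k = 0] the power is 1 and no parameter. *)
move=> pos eab; case: k => [|k] bi.
  rewrite mul1r (@eq_pow_ideal _ _ _ beta alpha) // => j.
  by have [->|/eab] := eqVneq j i; rewrite ?bi ?addn0.
pose s2 := [seq x j ^+ alpha j | j <- rem i (enum 'I_d)].
have mem2 j : j != i -> x j ^+ alpha j \in s2.
  by move=> ji; apply: map_f; rewrite mem_rem_uniq ?enum_uniq // !inE ji mem_enum.
have sub : pow_ideal x beta `<=` @lincomb R R^o (x i ^+ beta i :: s2).
  apply: (@lincomb_subset R R^o) => _ /mapP[j _ ->].
  have [->|ji] := eqVneq j i; first by rewrite mem_head.
  by rewrite eab // inE mem2 ?orbT.
move=> /sub[c]; rewrite /GRing.scale /= => hc.
suff : @lincomb R R^o (x i ^+ alpha i :: s2) r.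
  apply: (@lincomb_subset R R^o) => z; rewrite inE => /predU1P[->|/mapP[j _ ->]];
    by apply: map_f; rewrite mem_enum.
exists c; rewrite /GRing.scale /=.
have [n [K [e [delta [Kinj [einj [ex0 [exS Kbd]]]]]]]] := R_gorenstein.
apply: (@parameters_regular R K e delta Kinj einj ex0 exS R_noetherian m R_local n d Kbd
  R_dim (x i ^+ k.+1 :: s2) _ _ _ [::] (x i ^+ k.+1) s2) => //.
- rewrite /= size_map size_rem ?mem_enum // size_enum_ord prednK //.
  exact: leq_ltn_trans (leq0n _) (ltn_ord i).
- move=> z; rewrite inE => /predU1P[->|/mapP[j _ ->]]; apply: m_pow => //;
    exact: params_m.
- move=> P hP sP; apply: params_prime => // j; have [->|ji] := eqVneq j i.
    by apply: (prime_pow hP (n := k.+1)); apply: sP; rewrite mem_head.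
  by apply: (prime_pow hP (n := alpha j)); apply: sP; rewrite inE mem2 ?orbT.
- have -> : x i ^+ k.+1 * (r - c * x i ^+ alpha i) =
      x i ^+ k.+1 * r - c * x i ^+ beta i by rewrite bi exprD; ring.
  exact: hc.
Qed.

(** The factors [x j ^+ k] are cancelled in turn; the list [l] holds the indices whose exponent is
    still [n + k]. *)
Lemma pow_colon n k r : (0 < n)%N -> qn (k + n)%N (y ^+ k * r) -> qn n r.
Proof.
move=> n0; rewrite -prodrXl.
have H l : uniq l -> pow_ideal x (fun j => n + (j \in l) * k)%N
    ((\prod_(j <- l) x j ^+ k) * r) -> qn n r.
  elim: l => [|i l IH] /=.
    by rewrite big_nil mul1r (@eq_pow_ideal _ _ _ _ (fun=> n)) // => j; rewrite addn0.
  move=> /andP[il ul]; rewrite big_cons -mulrA => h; apply: IH => //.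
  apply: pow_regular h => [j|j ji|]; first by lia.
    by rewrite inE (negbTE ji).
  by rewrite mem_head (negbTE il) mul0n mul1n addn0.
move=> h; apply: (H (index_enum 'I_d)); first exact: index_enum_uniq.
rewrite (@eq_pow_ideal _ _ _ _ (fun=> k + n)%N) // => j.
by rewrite mem_index_enum mul1n addnC.
Qed.

Lemma pow_dual n (I : set R) z b : (0 < n)%N -> ideal I -> qn n `<=` I ->
  (forall r, I (r * z) -> qn n (r * b)) ->
  exists2 c, (forall r, I r -> qn n (r * c)) & qn n (b - z * c).
Proof.
move=> n0; have [l [K [e [delta [Kinj [einj [ex0 [exS Kbd]]]]]]]] := R_gorenstein.
apply: (@parameters_dual R K e delta Kinj einj ex0 exS R_noetherian m R_local l d Kbd
  R_dim (pow_gens x (fun=> n))).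
- by rewrite size_map size_enum_ord.
- by move=> _ /mapP[j _ ->]; apply: m_pow => //; apply: params_m.
- move=> P hP sP; apply: params_prime => // j; apply: (prime_pow hP (n := n)).
  by apply: sP; apply: map_f; rewrite mem_enum.
Qed.

(* E = H^d_m(R), with generators eps n = 1 / (x_1 ... x_d)^n *)
Local Notation E := (cech_top x R^o).
Local Notation eps n := (cfrac x (1 : R^o) n).

Lemma cfrac_eps (r : R) n : cfrac x (r : R^o) n = r *: eps n.
Proof. by rewrite cfracZ /GRing.scale /= mulr1. Qed.

Lemma eps_eq0 (r : R) n : (0 < n)%N -> r *: eps n = 0 <-> qn n r.
Proof.
move=> n0; split=> [|qr]; last exact: cfrac_pow_ideal.
by rewrite -cfrac_eps => /cfrac_eq0[k]; apply: pow_colon.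
Qed.

Lemma eps_expand (r : R) n k : (y ^+ k * r) *: eps (k + n) = r *: eps n.
Proof. by rewrite -!cfrac_eps -[RHS](cfrac_expand _ _ _ k). Qed.

(** Over the denominator [y ^+ (k + n)], the numerator of [c] is killed by all that kills [y ^+ k]
    modulo q_(k+n). By self-injectivity of R/q_(k+n) it is a multiple of [y ^+ k], which cancels. *)
Lemma killed_eps (c : E) n : (0 < n)%N -> (forall a, qn n a -> a *: c = 0) ->
  exists b : R, c = b *: eps n.
Proof.
move=> n0; have [r [k ->]] := cfracP c; rewrite (cfrac_eps r k) -(eps_expand r k n) [(n + k)%N]addnC => hc.
have kn0 : (0 < k + n)%N by lia.
have [a ha|b _ hb] := pow_dual (z := y ^+ k) (b := y ^+ n * r) kn0
    (pow_ideal_ideal x _) (@subset_refl _ _).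
  apply/(eps_eq0 _ kn0); rewrite -scalerA; apply: hc.
  by apply: (pow_colon n0 (k := k)); rewrite mulrC.
exists b; apply/eqP; rewrite -subr_eq0 -(eps_expand b n k) -scalerBl.
by apply/eqP/eps_eq0.
Qed.

(** The values of [h] are killed by q_(n+1), hence multiples of [eps n.+1]; self-injectivity of
    R/q_(n+1) is applied to one generator of [I] at a time. *)
Lemma eps_baer n (I : set R) (h : R -> E) : ideal I -> qn n.+1 `<=` I ->
  (forall a r t, I r -> I t -> h (a * r + t) = a *: h r + h t) ->
  (forall r, qn n.+1 r -> h r = 0) -> exists c, forall r, I r -> h r = r *: c.
Proof.
move=> hI qI hlin hq; have n0 : (0 < n.+1)%N by [].
have hq1 := pow_ideal_ideal x (fun=> n.+1).
(* The premise keeps the induction over ideals inside [I], where [h] is linear. *)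
suff [//|c hc] : I `<=` I -> exists c : R, forall r, I r -> h r = (r * c) *: eps n.+1.
  by exists (c *: eps n.+1) => r /hc; rewrite scalerA.
have I0 : I 0 by apply: ideal0.
have hZ a r : I r -> h (a * r) = a *: h r.
  move=> Ir; have := hlin a r 0 Ir I0; rewrite addr0 => ->.
  by rewrite [h 0]hq ?addr0 //; apply: ideal0.
apply: (iadd_ind R_noetherian (J := qn n.+1)
  (Phi := fun L => L `<=` I -> exists c : R, forall r, L r -> h r = (r * c) *: eps n.+1)) => //.
  by move=> _; exists 0 => r /hq ->; rewrite mulr0 scale0r.
move=> L z hL qL IH LI; have Iz : I z by apply/LI/mem_iadd.
have [c hc] := IH (subset_trans (@sub_iadd _ L z) LI).
have [b hb] : exists b : R, h z = b *: eps n.+1.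
  by apply: killed_eps => // a qa; rewrite -hZ // hq //; apply: ideal_mulr.
(* Adding [c'] to [c] corrects the value at [z] and preserves those on [L], which kills [c'] modulo
   q_(n+1). *)
have [r Lrz|c' Lc' hc'] := @pow_dual n.+1 L z (b - z * c) n0 hL qL.
  apply/(eps_eq0 _ n0); rewrite mulrBr scalerBl -scalerA -hb -hZ // hc //.
  by rewrite mulrA subrr.
exists (c + c') => r [t Lr].
have Ir' : I (r - t * z) by apply/LI/sub_iadd.
have -> : h r = t *: h z + h (r - t * z).
  by rewrite -hlin //; congr h; ring.
rewrite (hc _ Lr) hb scalerA -scalerDl; apply/eqP; rewrite -subr_eq0 -scalerBl.
apply/eqP/eps_eq0 => //.
have -> : t * b + (r - t * z) * c - r * (c + c') =
    t * (b - z * c - z * c') - (r - t * z) * c' by ring.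
by apply: ideal_sub => //; [apply: ideal_mull|apply: Lc'].
Qed.

Lemma eps1_neq0 : eps 1 <> 0.
Proof.
rewrite -[eps 1]scale1r => /(eps_eq0 _ (ltn0Sn _)) q1.
exact: (m_n1 R_local (pow_ideal_m (fun=> ltn0Sn _) q1)).
Qed.

Lemma eps_socle : exists2 c : E, c <> 0 & forall r, m r -> r *: c = 0.
Proof.
have [||a na ma] := @mprimary_socle R m R_noetherian (qn 1) (pow_ideal_ideal x _).
- exact: pow_ideal_mprimary.
- by move=> /(pow_ideal_m (fun=> ltn0Sn _)); apply: m_n1.
exists (a *: eps 1); first by move=> /(eps_eq0 _ (ltn0Sn _)).
by move=> r mr; rewrite scalerA; apply/eps_eq0 => //; apply: ma.
Qed.

(** The annihilator of [g] lies in [m], so [g] can be sent to a nonzero socle element; Baer's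
    criterion extends this map. *)
Lemma cech_cogenerator (M : lmodType R) (g : cech_top x M) : g <> 0 ->
  exists psi : {linear cech_top x M -> E}, psi g <> 0.
Proof.
move=> g0; have [c c0 mc] := eps_socle.
have [||psi hpsi] := @baer_extend R (cech_top x M) E (fun n => qn n.+1) _ eps_baer g c.
- move=> h; have [u [n ->]] := cfracP h; exists n => a qa.
  rewrite -(cfrac_expand x u n 1) add1n; exact: cfrac_pow_ideal.
- move=> r rg; apply: mc; apply: contrapT => nr.
  have [u ur] := not_m_unit R_noetherian R_local nr.
  by apply: g0; rewrite -(scale1r g) -ur -scalerA rg scaler0.
- by exists psi; rewrite hpsi.
Qed.

Lemma idealX_ideal n : ideal (idealX m n).
Proof.
split; first by move=> J [hJ _]; apply: ideal0.
  by move=> a b ha hb J hJs; have [hJ _] := hJs; apply: ideal_add (ha _ hJs) (hb _ hJs).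
by move=> a b hb J hJs; have [hJ _] := hJs; apply: ideal_mull (hb _ hJs).
Qed.

Lemma pow_ideal_idealX n : qn n `<=` idealX m n.
Proof.
apply: pow_ideal_sub; first exact: idealX_ideal.
move=> i; apply: sub_gen_smallest; exists (fun=> x i); split; first by move=> _; apply: params_m.
by rewrite prodr_const card_ord.
Qed.

Hypothesis R_complete : adically_complete m.

Lemma idealX_anti n k : (n <= k)%N -> idealX m k `<=` idealX m n.
Proof.
move=> nk; apply: smallest_sub; first exact: idealX_ideal.
move=> _ [a [ma ->]]; move: a ma; rewrite -(subnKC nk) => a ma.
rewrite big_split_ord /=; apply: (ideal_mulr _ (idealX_ideal n)).
by apply: sub_gen_smallest; exists (fun i => a (lshift _ i)).
Qed.

Lemma eps_faithful (r : R) : (forall n, r *: eps n.+1 = 0) -> r = 0.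
Proof.
move=> hr; have [sep _] := R_complete; apply: sep => n.
apply: (@idealX_anti n n.+1) => //; apply: (@pow_ideal_idealX n.+1).
exact/(eps_eq0 _ (ltn0Sn n)).
Qed.

(* Endomorphisms of H^d_m(R) are homotheties, R being complete. *)
Lemma eps_limit (w : nat -> E) :
  (forall n, w n = y *: w n.+1) -> (forall n a, qn n.+1 a -> a *: w n = 0) ->
  exists r : R, forall n, w n = r *: eps n.+1.
Proof.
move=> wS wq.
have wit n : exists b : R, w n = b *: eps n.+1 by apply: killed_eps (wq n).
have [u hu] := choice wit.
have wk n k : w n = y ^+ k *: w (k + n)%N.
  elim: k => [|k IH]; first by rewrite scale1r.
  by rewrite IH wS scalerA -exprSr.
have hun n i : (n <= i)%N -> w n = u i *: eps n.+1.
  move=> ni; rewrite (wk n (i - n)%N) subnK // hu scalerA.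
  by rewrite -[RHS](eps_expand _ _ (i - n)) addnS subnK.
have hq n i j : (n <= i)%N -> (n <= j)%N -> qn n.+1 (u i - u j).
  move=> ni nj; apply/eps_eq0 => //.
  by rewrite scalerBl -(hun _ _ ni) -(hun _ _ nj) subrr.
have [_ lim] := R_complete; have [n|l hl] := lim u.
  exists n => i j ni nj; apply: (@idealX_anti n n.+1) => //.
  by apply: (@pow_ideal_idealX n.+1); apply: hq.
exists l => n.
(* The m-adic limit [l] is also a limit modulo q_(n+1), which contains a power of [m]. *)
have [k hk] := mprimary_pow R_noetherian (pow_ideal_ideal x (fun=> n.+1)) (@pow_ideal_mprimary _).
have [N hN] := hl k.
pose i := maxn n N; have := hN i (leq_maxr _ _) => /hk /(eps_eq0 _ (ltn0Sn n)).
rewrite scalerBl -(hun n i (leq_maxl _ _)) => /eqP.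
by rewrite subr_eq0 => /eqP.
Qed.

(* Matlis duality *)
Lemma cech_functional (M : lmodType R) (psi : {linear cech_top x M -> E}) :
  exists phi : {linear M -> R^o}, forall v n,
    psi (cfrac x v n.+1) = (phi v : R) *: eps n.+1.
Proof.
have wit v : exists r : R, forall n, psi (cfrac x v n.+1) = r *: eps n.+1.
  apply: eps_limit => n; last by move=> a qa; rewrite -linearZ cfrac_pow_ideal // linear0.
  by rewrite -linearZ cfracZ -(cfrac_expand x v n.+1 1) expr1.
have [phi hphi] := choice wit.
have phil : linear (phi : M -> R^o).
  move=> a u v; apply/eqP; rewrite -subr_eq0; apply/eqP/eps_faithful => n.
  rewrite scalerBl -hphi cfrac_linear linearP !hphi scalerDl scalerA.
  exact: subrr.
by exists (HB.pack (phi : M -> R^o) (GRing.isLinear.Build R M R^o _ phi phil) : {linear M -> R^o}).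
Qed.

End GorensteinParameters.

(** * Parasolid algebras and the order ideal *)

Theorem corollary2p5 (R : comNzRingType) (m : set R) (d : nat)
    (R_noetherian : noetherian R) (R_local : local_ring m)
    (R_dim : krull_dim R d) (R_complete : adically_complete m)
    (R_gorenstein : gorenstein R)
    (A : comPzRingType) (f : {rmorphism R -> A}) :
  parasolid f m d <->
  (forall x : 'I_d -> R, parameters m x ->
     ~ (order_ideal f `<=` Ann (paraclass x))).
Proof.
split=> [para x x_par sub|noann x x_par _ eta0].
  have eps0 := eps1_neq0 R_noetherian R_local R_dim R_gorenstein x_par.
  have := para x x_par eps0; rewrite [cech_map _ _]cech_map_cfrac => eta0.
  have [psi psi0] := cech_cogenerator R_noetherian R_local R_dim R_gorenstein x_par eta0.
  have [phi hphi] := cech_functional R_noetherian R_local R_dim R_gorenstein x_par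
    R_complete psi.
  (* For [n = 0], [hphi] says that [psi] sends the image of the paraclass to its multiple by [phi]
     of 1, an element of the order ideal. *)
  apply: psi0; rewrite hphi; apply: sub; exists phi.
  by rewrite /alg_struct rmorph1.
apply: (noann x x_par) => _ [phi <-].
(* The composite of [alg_struct f] and [phi] is multiplication by [phi] of 1, so this class is that
   multiple of the paraclass. *)
have : cech_map phi (cech_map (alg_struct f) (paraclass x)) = 0.
  by rewrite eta0 -(cfrac0 x _ 0) cech_map_cfrac linear0 cfrac0.
rewrite [cech_map _ (paraclass x)]cech_map_cfrac cech_map_cfrac /alg_struct rmorph1.
by rewrite cfrac_eps.
Qed.
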